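(* Consider the minimization of $f:\mathbb{R}^d\to\mathbb{R}$, where $f(x)=\frac1n\sum_{i=1}^n f_i(x)$ with differentiable, possibly nonconvex $f_i$ (finite-sum case), or $f(x)=\mathbb{E}_{\zeta\sim\mathcal{D}}[F(x,\zeta)]$ (online case, treated as a finite sum with $f_i(x)=F(x,\zeta_i)$ and $n$ very large or infinite, as described in the context). Let $x^0\in\mathbb{R}^d$, $\Delta_0:=f(x^0)-\min_{x\in\mathbb{R}^d} f(x)$, and let $\epsilon>0$. Let $b,b'\ge 1$ be integer minibatch sizes, and run the algorithm PAGE (defined in the context) from $x^0$ with constant probability $p_t\equiv p:=\frac{b'}{b+b'}$ and stepsize $\eta>0$ satisfying $$\eta\le\frac{1}{L\left(1+\sqrt{\frac{1-p}{pb'}}\right)}.$$ Let $\widehat{x}_T$ be the output after $T$ iterations. Then PAGE can find an $\epsilon$-approximate solution, i.e. $\mathbb{E}[\|\nabla f(\widehat{x}_T)\|]\le\epsilon$. Two cases are distinguished. 1. (Finite-sum case) Suppose $f$ is average $L$-smooth. Let the minibatch size be $b=n$ and take any $b'\le\sqrt{b}$. Then the number of iterations can be bounded by $$T=\frac{2L\Delta_0}{\epsilon^2}\left(1+\sqrt{\frac{1-p}{pb'}}\right)\le\frac{4L\Delta_0\sqrt{n}}{\epsilon^2 b'},$$ and the number of stochastic gradient computations (i.e. the gradient complexity) is $$\#\mathrm{grad}=b+T\big(pb+(1-p)b'\big)\le n+\frac{8L\Delta_0\sqrt{n}}{\epsilon^2}=O\Big(n+\frac{\sqrt n}{\epsilon^2}\Big),$$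 where the first $b$ in $\#\mathrm{grad}$ is due to the computation of $g^0$. 2. (Online case) Suppose $f$ is average $L$-smooth and the stochastic gradient has bounded variance with constant $\sigma>0$. Let the minibatch size be $b=\min\big\{\lceil \frac{2\sigma^2}{\epsilon^2}\rceil,\,n\big\}$ and take any $b'\le\sqrt b$. Then the number of iterations can be bounded by $$T=\frac{4L\Delta_0}{\epsilon^2}\left(1+\sqrt{\frac{1-p}{pb'}}\right)+\frac1p\le\frac{8L\Delta_0\sqrt b}{\epsilon^2b'}+\frac{b+b'}{b'},$$ and the number of stochastic gradient computations (i.e. the gradient complexity) is $$\#\mathrm{grad}=b+T\big(pb+(1-p)b'\big)\le 3b+\frac{16L\Delta_0\sqrt b}{\epsilon^2}=O\Big(b+\frac{\sqrt b}{\epsilon^2}\Big).$$ The $O(\cdot)$ notation hides the factor $L\Delta_0$ and numerical constants.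
   Context: Norms are Euclidean. $\mathbb{E}_i$ denotes expectation over a uniformly random index $i\in\{1,\dots,n\}$. The minimum of $f$ over $\mathbb{R}^d$ is assumed to exist. Online form: $f(x)=\mathbb{E}_{\zeta\sim\mathcal{D}}[F(x,\zeta)]$, with $F(\cdot,\zeta)$ differentiable and possibly nonconvex. It is written as the finite-sum form with $f_i(x):=F(x,\zeta_i)$ and $n$ very large or infinite. If $n=\infty$, drawing a random index $i$ means drawing a fresh $\zeta_i\sim\mathcal{D}$, $\mathbb{E}_i$ is the expectation over $\zeta_i\sim\mathcal{D}$, the identity $\nabla f(x)=\frac1n\sum_i\nabla f_i(x)$ is read as $\nabla f(x)=\mathbb{E}_i[\nabla f_i(x)]$, and $\min\{m,n\}=m$ for finite $m$. Average $L$-smoothness: $L>0$ and $\mathbb{E}_i[\|\nabla f_i(x)-\nabla f_i(y)\|^2]\le L^2\|x-y\|^2$ for all $x,y\in\mathbb{R}^d$. Bounded variance: $\sigma>0$ and $\mathbb{E}_i[\|\nabla f_i(x)-\nabla f(x)\|^2]\le\sigma^2$ for all $x\in\mathbb{R}^d$. Algorithm PAGE (ProbAbilistic Gradient Estimator), with initial point $x^0$, stepsize $\eta$, minibatch sizes $b,b'$, probabilities $p_t\in(0,1]$: - Set $g^0=\frac1b\sum_{i\in I}\nabla f_i(x^0)$, where $I$ is a random minibatch with $|I|=b$. - For $t=0,1,2,\dots$: set $x^{t+1}=x^t-\eta g^t$; then, with probability $p_t$, set $g^{t+1}=\frac1b\sum_{i\in I}\nabla f_i(x^{t+1})$ with a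 random minibatch $I$, $|I|=b$; and with probability $1-p_t$, set $g^{t+1}=g^t+\frac1{b'}\sum_{i\in I'}\big(\nabla f_i(x^{t+1})-\nabla f_i(x^t)\big)$ with a random minibatch $I'$, $|I'|=b'$. - Output after $T$ iterations: $\widehat{x}_T$ chosen uniformly at random from $\{x^0,x^1,\dots,x^{T-1}\}$, independently of everything else. Sampling conventions: fresh minibatches and a fresh coin flip are used at each iteration, independent of each other and of the past. Minibatch indices are drawn independently and uniformly (from $\mathcal{D}$ if $n=\infty$), except that a minibatch $I$ of size $b=n$ is the full index set, so that $\frac1b\sum_{i\in I}\nabla f_i=\nabla f$ in that case. Counting convention: $\#\mathrm{grad}$ is the (expected) number of stochastic gradient computations, where $g^0$ costs $b$, an update with minibatch $I$ costs $b$, and an update with minibatch $I'$ costs $b'$; hence $\#\mathrm{grad}=b+T(pb+(1-p)b')$. Rounding is ignored: the displayed value of $T$ is taken to be a positive integer. The expectation $\mathbb{E}[\|\nabla f(\widehat{x}_T)\|]$ is over all randomness of the algorithm, including the choice of $\widehat{x}_T$.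
   Formalization: With the displayed T the ε-guarantee is false for very small admissible η, so it is stated for η = 1/(L(1+√((1-p)/(pb')))); for every smaller admissible η it is stated for T ≥ 2Δ₀/(ηε²) (online: T ≥ 4Δ₀/(ηε²)+1/p). *)

(* Defs.v *)
From HB Require Import structures.
From mathcomp Require Import all_boot all_order all_algebra.
From mathcomp Require Import all_classical all_reals all_analysis.
From mathcomp Require Import lra.
Import Order.TTheory GRing.Theory Num.Theory.
Import numFieldNormedType.Exports.

Set Implicit Arguments.
Unset Strict Implicit.
Unset Printing Implicit Defensive.

Local Open Scope classical_set_scope.
Local Open Scope ring_scope.

(* The library norm on ['rV[R]_d] is the sup norm, hence this definition; the
   two induce the same topology, so [differentiable] is unaffected. *)
Definition enorm {R : realType} {d : nat} (v : 'rV[R]_d) : R :=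
  Num.sqrt (\sum_j v ord0 j ^+ 2).

Definition grad {R : realType} {d : nat} (f : 'rV[R]_d -> R) (x : 'rV[R]_d) :
  'rV[R]_d := \row_j 'D_(delta_mx ord0 j) f x.

HB.instance Definition _ (n : nat) := isPointed.Build 'I_n.+1 ord0.
HB.instance Definition _ (n : nat) := @isMeasurable.Build
  default_measure_display 'I_n.+1 discrete_measurable discrete_measurable0
  discrete_measurableC discrete_measurableU.

Section uniform_index.
Context (R : realType) (n : nat).
Local Open Scope ereal_scope.

Definition uniform_index : set 'I_n.+1 -> \bar R :=
  mscale (n.+1%:R^-1)%:nng%R
    (msum (fun k => \d_(inord k : 'I_n.+1)) n.+1).

HB.instance Definition _ := Measure.on uniform_index.

Let uniform_index_setT : uniform_index setT = 1.
Proof.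
rewrite /uniform_index /mscale /= /msum.
rewrite (eq_bigr (fun=> 1)) => [|k _]; last exact: diracT.
rewrite sumEFin big_const_ord iter_addr addr0 -EFinM.
by rewrite mulVf// pnatr_eq0.
Qed.

HB.instance Definition _ :=
  Measure_isProbability.Build _ _ _ uniform_index uniform_index_setT.

Lemma expectation_uniform_index (X : 'I_n.+1 -> R) :
  'E_uniform_index[X] = (n.+1%:R^-1 * \sum_i X i)%R%:E.
Proof.
have key (Y : 'I_n.+1 -> \bar R) : (forall i, 0 <= Y i) ->
    \int[uniform_index]_i Y i = (n.+1%:R^-1)%R%:E * \sum_i Y i.
  move=> Y0; rewrite ge0_integral_mscale//= ge0_integral_measure_sum//.
  congr *%E; apply: eq_bigr => i _.
  by rewrite integral_dirac// diracT mul1e inord_val.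
rewrite unlock integralE !key//.
have -> : \sum_i (fun i => (X i)%:E)^\+ i = (\sum_i Num.max (X i) 0)%:E.
  by rewrite -sumEFin; apply: eq_bigr => i _; rewrite funeposE EFin_max.
have -> : \sum_i (fun i => (X i)%:E)^\- i = (\sum_i Num.max (- X i) 0)%:E.
  by rewrite -sumEFin; apply: eq_bigr => i _; rewrite funenegE EFin_max EFinN.
rewrite -!EFinM -EFinB -mulrBr -sumrB; congr (_ * _)%R%:E.
apply: eq_bigr => i _.
by case: (lerP (X i) 0) => ?; case: (lerP (- X i)%R 0) => ?; lra.
Qed.

End uniform_index.
Arguments uniform_index : clear implicits.

Section stochastic_objective.
Context {R : realType} {d : nat} {dZ : measure_display} {Z : measurableType dZ}.
Variables (D : probability Z R) (F : Z -> 'rV[R]_d -> R) (f : 'rV[R]_d -> R).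

(* [f x = E F(x, .)], with [grad f x = E grad F(x, .)] coordinatewise. *)
Definition stochastic_objective : Prop :=
  [/\ forall z x, differentiable (F z) x,
      forall x, D.-integrable setT (fun z => (F z x)%:E) /\
        ('E_D[fun z => F z x] = (f x)%:E)%E,
      forall x, differentiable f x
    & forall x j, D.-integrable setT (fun z => (grad (F z) x ord0 j)%:E) /\
        ('E_D[fun z => grad (F z) x ord0 j] = (grad f x ord0 j)%:E)%E].

Definition average_smooth (L : R) : Prop := forall x y,
  ('E_D[fun z => (enorm (grad (F z) x - grad (F z) y) ^+ 2)%R] <=
   (L ^+ 2 * enorm (x - y) ^+ 2)%R%:E)%E.

Definition bounded_variance (sigma : R) : Prop := forall x,
  ('E_D[fun z => (enorm (grad (F z) x - grad f x) ^+ 2)%R] <= (sigma ^+ 2)%R%:E)%E.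

End stochastic_objective.

(* The population drawn from: [Some [:: z_1; ...; z_n]] for a finite population
   of size [n], of which [D] is then the empirical law (repetitions allowed), so
   that a [D]-draw is [z_i] for a uniformly random index [i]; [None] when
   [n] is infinite and [D] is arbitrary. *)
Definition population {R : realType} {dZ : measure_display}
    {Z : measurableType dZ} (D : probability Z R) (pop : option (seq Z)) : Prop :=
  if pop is Some zs then
    (0 < size zs)%N /\ forall A, measurable A ->
      D A = ((size zs)%:R^-1 * \sum_(z <- zs) \1_A z)%:E
  else True.

(* [s] holds the independent draws; they are discarded in favour of the full
   index set when the minibatch size equals the size of the population. *)
Definition minibatch {Z : Type} (pop : option (seq Z)) (s : seq Z) : seq Z :=
  if pop is Some zs then if size s == size zs then zs else s else s.

Section page.
Context {R : realType} {d : nat} {Z : Type}.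
Variables (F : Z -> 'rV[R]_d -> R) (x0 : 'rV[R]_d) (eta : R).
Variables (I I' : nat -> seq Z) (coin : nat -> bool).

(* The pair [(x^t, g^t)] for realised minibatches and coins: [I 0] serves for
   [g^0], and [coin t], [I t.+1], [I' t] for the update from [g^t] to
   [g^{t+1}]. *)
Fixpoint page_state (t : nat) : 'rV[R]_d * 'rV[R]_d :=
  if t is t'.+1 then
    let: (x, g) := page_state t' in
    let x1 := x - eta *: g in
    (x1, if coin t'
         then (size (I t))%:R^-1 *: \sum_(z <- I t) grad (F z) x1
         else g + (size (I' t'))%:R^-1 *:
                    \sum_(z <- I' t') (grad (F z) x1 - grad (F z) x))
  else (x0, (size (I 0%N))%:R^-1 *: \sum_(z <- I 0%N) grad (F z) x0).

End page.

(* Each [G i] is a family of events; used below with generated sigma-algebras. *)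
Definition mutually_independent {R : realType} {dO : measure_display}
    {Omega : measurableType dO} (P : probability Omega R) {J : eqType}
    (G : J -> set (set Omega)) : Prop :=
  forall (s : seq J) (E : J -> set Omega), uniq s ->
    (forall i, i \in s -> G i (E i)) ->
    P (\big[setI/setT]_(i <- s) E i) = (\prod_(i <- s) P (E i))%E.

Section page_randomness.
Context {R : realType} {dO : measure_display} {Omega : measurableType dO}.
Context {dZ : measure_display} {Z : measurableType dZ}.
Variables (P : probability Omega R) (D : probability Z R).
Variables (b b' : nat) (p : nat -> R) (T : nat).

Definition source : Type := (nat * 'I_b + nat * 'I_b' + nat + unit)%type.

Definition source_events (draw : nat -> 'I_b -> Omega -> Z)
    (draw' : nat -> 'I_b' -> Omega -> Z) (coin : nat -> Omega -> bool)
    (out : Omega -> nat) (i : source) : set (set Omega) :=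
  match i with
  | inl (inl (inl (t, j))) => preimage_set_system setT (draw t j) measurable
  | inl (inl (inr (t, j))) => preimage_set_system setT (draw' t j) measurable
  | inl (inr t) => preimage_set_system setT (coin t) measurable
  | inr tt => preimage_set_system setT out measurable
  end.

(* Both kinds of minibatch are drawn at every step, the coin selecting the one
   that is used. *)
Record page_randomness := PageRandomness {
  draw : nat -> 'I_b -> {RV P >-> Z} ;
  draw' : nat -> 'I_b' -> {RV P >-> Z} ;
  coin : nat -> {RV P >-> bool} ;
  out : {RV P >-> nat} ;
  draw_law : forall t j A, measurable A -> distribution P (draw t j) A = D A ;
  draw'_law : forall t j A, measurable A -> distribution P (draw' t j) A = D A ;
  coin_law : forall t, distribution P (coin t) [set true] = (p t)%:E ;
  out_law : forall t, (t < T)%N ->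
    distribution P out [set t] = (T%:R^-1)%:E ;
  page_independence : mutually_independent P (source_events
    (fun t j => draw t j) (fun t j => draw' t j) (fun t => coin t) out)
}.

End page_randomness.

Section page_run.
Context {R : realType} {dO : measure_display} {Omega : measurableType dO}.
Context {dZ : measure_display} {Z : measurableType dZ}.
Context {P : probability Omega R} {D : probability Z R}.
Context {b b' : nat} {p : nat -> R} {T : nat} {d : nat}.

Definition page_iterate (pop : option (seq Z)) (F : Z -> 'rV[R]_d -> R)
    (x0 : 'rV[R]_d) (eta : R) (r : page_randomness P D b b' p T)
    (w : Omega) (t : nat) : 'rV[R]_d :=
  (page_state F x0 eta
    (fun t => minibatch pop [seq draw r t j w | j <- enum 'I_b])
    (fun t => [seq draw' r t j w | j <- enum 'I_b'])
    (fun t => coin r t w) t).1.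

Definition page_output (pop : option (seq Z)) (F : Z -> 'rV[R]_d -> R)
    (x0 : 'rV[R]_d) (eta : R) (r : page_randomness P D b b' p T)
    (w : Omega) : 'rV[R]_d :=
  page_iterate pop F x0 eta r w (out r w).

(* Stochastic gradient computations in [T] iterations, in the convention where
   an update on a minibatch [I'] is charged [b']. *)
Definition page_grad_count (r : page_randomness P D b b' p T) (w : Omega) : R :=
  (b + \sum_(t < T) if coin r t w then b else b')%:R.

End page_run.

(* Main.v *)
(* With Phi_t = f(x^t) - f(xmin) + eta/(2p) |g^t - grad f(x^t)|^2, the descent lemma
   for the L-smooth function f bounds the decrease of f by the estimation error, while
   the coin flip and the fresh minibatches contract that error by 1 - p, up to a
   multiple of |x^{t+1} - x^t|^2 that the step size lets the descent lemma absorb.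
   Telescoping E[Phi_t] bounds the average of E|grad f(x^t)|^2. *)

From HB Require Import structures.
Require Import Defs.
From mathcomp Require Import all_boot all_order all_algebra.
From mathcomp Require Import all_classical all_reals all_analysis.
From mathcomp Require Import measurable_realfun.
From mathcomp Require Import ring lra.
Import Order.TTheory GRing.Theory Num.Theory.
Import numFieldNormedType.Exports.
Set Implicit Arguments.
Unset Strict Implicit.
Unset Printing Implicit Defensive.
Local Open Scope classical_set_scope.
Local Open Scope ring_scope.

(** * Joint measurability of gradients *)

(** Conditioning on the past is carried out by freezing: the joint law of the past and of one fresh
    source is a product measure, so Tonelli integrates the fresh source first while the past stays
    fixed. This requires the iterates to be measurable for the sigma-algebra of the sources already
    used, and the gradients to be jointly measurable in sample and point. The hypotheses only make
    [F z] differentiable and each [F ^~ y] integrable, hence measurable; joint measurability has to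
    be derived.

    No moment of the iterates is assumed finite. The recursions are therefore stated between
    integrals of nonnegative functions in [\bar R], with sums only and no subtraction of integrals;
    finiteness is then obtained by induction on [t], and only afterwards does the telescoping take
    place in [R].

    One analysis serves both cases through a variance level [V] for the large minibatch: [V = 0]
    when the minibatch is the full index set, and otherwise [V = eps ^+ 2 / 2], which spends half of
    the target accuracy on sampling noise. *)

Section measurable_gradient.
Context {R : realType} {d : nat} {dT dZ : measure_display}.
Context {T : measurableType dT} {Z : measurableType dZ}.

(* The level-[m] grid point below [x] differs from [x] by at most [1/(m+1)] and, as a
   function of [x], takes countably many values. *)
Let grid (m : nat) (x : 'rV[R]_d) : 'rV[int]_d :=
  \row_k Num.floor (m.+1%:R * x ord0 k).

Let unscale (m : nat) (q : 'rV[int]_d) : 'rV[R]_d :=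
  \row_k ((q ord0 k)%:~R / m.+1%:R).

Let unscale_grid_cvg (x : 'rV[R]_d) : unscale m (grid m x) @[m --> \oo] --> x.
Proof.
apply/cvgrPdist_le => e e0.
have := @cvg_harmonic R => /cvgrPdist_le /(_ e e0); apply: filterS => m.
rewrite sub0r normrN ger0_norm ?harmonic_ge0// => hm.
rewrite /Num.norm/= mx_normrE; apply: bigmax_le; first exact: ltW.
move=> [i k] _; rewrite !mxE (ord1 i)/=; apply: le_trans hm.
have m0 : 0 < m.+1%:R :> R by rewrite ltr0n.
have /andP[h1 h2] := floor_itv (m.+1%:R * x ord0 k).
set q := Num.floor _ in h1 h2 *.
rewrite ger0_norm; last by rewrite subr_ge0 ler_pdivrMr// mulrC.
rewrite lerBlDr /harmonic/= -[X in X + _]mul1r -mulrDl ler_pdivlMr// mulrC (le_trans (ltW h2))//.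
by rewrite intrD addrC.
Qed.

(** With the second argument rounded to the grid, the map is measurable because that argument is
    constant on each of countably many cells, where measurability in [z] alone suffices. Continuity
    then recovers the original map as a pointwise limit. *)
Lemma measurable_caratheodory (F : Z -> 'rV[R]_d -> R) (X : T -> Z) (x : T -> 'rV[R]_d) :
  (forall z, continuous (F z)) -> (forall y, measurable_fun setT (F ^~ y)) ->
  measurable_fun setT X -> (forall k, measurable_fun setT (fun w => x w ord0 k)) ->
  measurable_fun setT (fun w => F (X w) (x w)).
Proof.
move=> Fc Fm mX mx.
apply: (measurable_fun_cvg (h := fun m w => F (X w) (unscale m (grid m (x w))))); last first.
  move=> w _; by apply: continuous_cvg; [exact: Fc|exact: unscale_grid_cvg].
move=> m _ B mB; rewrite setTI.
rewrite (_ : _ @^-1` _ = \bigcup_(q : 'rV[int]_d) ([set w | grid m (x w) = q] `&`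
   (F ^~ (unscale m q) \o X) @^-1` B)); last first.
  apply/seteqP; split=> w/=; first by move=> ?; exists (grid m (x w)).
  by move=> [q _ [<-]].
apply: countable_bigcupT_measurable => [|q]; first exact: countableP.
apply: measurableI; last first.
  rewrite -[X in measurable X]setTI.
  by apply: (measurableT_comp (Fm _) mX).
rewrite (_ : [set w | _] = \bigcap_(k in [set: 'I_d]) [set w | Num.floor (m.+1%:R * x w ord0 k) = q ord0 k]); last first.
  apply/seteqP; split=> w/=; first by move=> <- k _; rewrite mxE.
  by move=> h; apply/rowP => k; rewrite mxE h.
apply: fin_bigcap_measurable => // k _.
rewrite (_ : [set w | _] = (fun w => m.+1%:R * x w ord0 k) @^-1`
   `[(q ord0 k)%:~R, (q ord0 k + 1)%:~R[%classic); last first.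
  apply/seteqP; split=> w/=; rewrite in_itv/=.
    by move=> <-; exact: floor_itv.
  by move=> /floor_def.
rewrite -[X in measurable X]setTI; apply: measurable_funM => //.
Qed.

(* The partial derivatives are limits of difference quotients of Caratheodory functions,
   so no continuity of the gradients is needed. *)
Lemma measurable_grad (F : Z -> 'rV[R]_d -> R) (X : T -> Z) (x : T -> 'rV[R]_d) k :
  (forall z y, differentiable (F z) y) -> (forall y, measurable_fun setT (F ^~ y)) ->
  measurable_fun setT X -> (forall k, measurable_fun setT (fun w => x w ord0 k)) ->
  measurable_fun setT (fun w => grad (F (X w)) (x w) ord0 k).
Proof.
move=> Fd Fm mX mx.
have Fc z : continuous (F z) by move=> y; exact: differentiable_continuous.
apply: (measurable_fun_cvg (h := fun m w => (harmonic m)^-1 *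
  (F (X w) (harmonic m *: delta_mx ord0 k + x w) - F (X w) (x w)))).
  move=> m; apply: measurable_funM => //; apply: measurable_funB.
    apply: measurable_caratheodory => // j.
    by under eq_fun do rewrite !mxE; apply: measurable_funD.
  exact: measurable_caratheodory.
move=> w _; rewrite mxE.
have /cvg_ex[l Fl] := @diff_derivable _ _ _ _ _ (delta_mx ord0 k) (Fd (X w) (x w)).
have -> : 'D_(delta_mx ord0 k) (F (X w)) (x w) = l.
  by rewrite /derive; exact: cvg_lim.
move/cvgr_dnbhsP : Fl => /(_ harmonic); apply; split; last exact: cvg_harmonic.
by move=> n; rewrite gt_eqF// harmonic_gt0.
Qed.

End measurable_gradient.

(** * Euclidean norm and the descent lemma *)

Section euclidean.
Context {R : realType} {d : nat}.
Implicit Types u v x y : 'rV[R]_d.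

(** Kept apart from [enorm] so that second-moment identities are polynomial in the coordinates;
    [enorm_sqr] is the link. *)
Definition sqnorm v : R := \sum_j v ord0 j ^+ 2.
Definition dot u v : R := \sum_j u ord0 j * v ord0 j.

Lemma sqnorm_ge0 v : 0 <= sqnorm v.
Proof. by apply: sumr_ge0 => j _; exact: sqr_ge0. Qed.

Lemma enorm_ge0 v : 0 <= enorm v.
Proof. exact: sqrtr_ge0. Qed.

Lemma enorm_sqr v : enorm v ^+ 2 = sqnorm v.
Proof. by rewrite sqr_sqrtr// sqnorm_ge0. Qed.

Lemma sqnorm0 : sqnorm 0 = 0.
Proof. by rewrite /sqnorm big1// => j _; rewrite mxE expr0n. Qed.

Lemma sqnormZ (a : R) v : sqnorm (a *: v) = a ^+ 2 * sqnorm v.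
Proof. by rewrite /sqnorm mulr_sumr; apply: eq_bigr => j _; rewrite mxE exprMn. Qed.

Lemma sqnormD u v : sqnorm (u + v) = sqnorm u + sqnorm v + 2 * dot u v.
Proof.
rewrite /sqnorm /dot mulr_sumr -!big_split; apply: eq_bigr => j _.
by rewrite !mxE /=; ring.
Qed.

Lemma sqnormB u v : sqnorm (u - v) = sqnorm u + sqnorm v - 2 * dot u v.
Proof.
rewrite /sqnorm /dot mulr_sumr -big_split -sumrB; apply: eq_bigr => j _.
by rewrite !mxE /=; ring.
Qed.

Lemma sqnormD_le u v : sqnorm (u + v) <= 2 * sqnorm u + 2 * sqnorm v.
Proof.
rewrite /sqnorm !mulr_sumr -big_split; apply: ler_sum => j _.
by rewrite !mxE /=; have := sqr_ge0 (u ord0 j - v ord0 j); nra.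
Qed.

Lemma dotBl u v w : dot (u - v) w = dot u w - dot v w.
Proof. by rewrite /dot -sumrB; apply: eq_bigr => j _; rewrite !mxE mulrBl. Qed.

Lemma dotZr (a : R) u v : dot u (a *: v) = a * dot u v.
Proof. by rewrite /dot mulr_sumr; apply: eq_bigr => j _; rewrite !mxE; ring. Qed.

(** [grad] collects partial derivatives only; differentiability makes the derivative linear in the
    direction, so expanding [v] in the canonical basis gives every directional derivative. *)
Lemma derive_dot_grad (f : 'rV[R]_d -> R) x v : differentiable f x ->
  'D_v f x = dot (grad f x) v.
Proof.
move=> fd; rewrite deriveE// {1}[v]row_sum_delta linear_sum /dot.
by apply: eq_bigr => j _; rewrite linearZ /= mxE deriveE// mulrC.
Qed.

Lemma is_derive_line (f : 'rV[R]_d -> R) x v (t : R) :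
  differentiable f (x + t *: v) ->
  is_derive t 1 (fun s => f (x + s *: v)) (dot (grad f (x + t *: v)) v).
Proof.
move=> fd; rewrite -derive_dot_grad//.
have E : (fun h : R => h^-1 *: (((fun s => f (x + s *: v)) \o shift t) (h *: 1) - f (x + t *: v))) =
    (fun h : R => h^-1 *: ((f \o shift (x + t *: v)) (h *: v) - f (x + t *: v))).
  apply/funext => h; congr (_ *: (f _ - _)).
  by rewrite /= [h *: 1]mulr1 scalerDl addrCA.
have fdv := @diff_derivable _ _ _ _ _ v fd.
by split; rewrite /derivable /derive E.
Qed.

(** The mean value theorem on [[0, 1]] for [g], which is [f] along the segment minus the claimed
    quadratic upper model: its derivative is nonpositive, so [g 1 <= g 0]. *)
Lemma smooth_descent (f : 'rV[R]_d -> R) (L : R) x y : 0 < L ->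
  (forall z, differentiable f z) ->
  (forall z z', sqnorm (grad f z - grad f z') <= L ^+ 2 * sqnorm (z - z')) ->
  f y <= f x + dot (grad f x) (y - x) + L / 2 * sqnorm (y - x).
Proof.
move=> L0 fd fL; set v := y - x.
pose g (t : R) := f (x + t *: v) - t * dot (grad f x) v - t ^+ 2 * (L / 2 * sqnorm v).
pose dg (t : R) := dot (grad f (x + t *: v)) v - dot (grad f x) v - t * (L * sqnorm v).
have gdg (t : R) : is_derive t 1 g (dg t).
  have h1 := @is_derive_line f x v t (fd _).
  apply: is_derive_eq.
  by rewrite /dg /GRing.scale/=; field.
have dg_le0 (s : R) : 0 < s -> dg s <= 0.
  move=> s0; rewrite /dg -dotBl subr_le0.
  set a := _ - _.
  have aL : sqnorm a <= (L * s) ^+ 2 * sqnorm v.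
    apply: le_trans (fL _ _) _.
    by rewrite addrAC subrr add0r sqnormZ mulrA exprMn.
  have Ls0 : 0 < L * s by exact: mulr_gt0.
  (* In place of Cauchy-Schwarz: expanding this square and using [aL] gives [2 * (L * s) * dot a v
     <= 2 * (L * s) ^+ 2 * sqnorm v], and [L * s > 0] cancels. *)
  have := sqnorm_ge0 (a - (L * s) *: v).
  rewrite sqnormB sqnormZ dotZr => h.
  rewrite -(ler_pM2l Ls0); nra.
have gc : {within `[0, 1], continuous g}.
  apply: derivable_within_continuous => r _.
  by have [] := gdg r.
have := @MVT_segment R g dg 0 1 ler01 (fun t _ => gdg t) gc.
move=> [c]; rewrite subr0 mulr1 in_itv/= => /andP[c0 c1].
rewrite /g !scale1r !scale0r addr0 /v (addrC x) subrK -/v.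
(* The point [c] lies in the closed interval, so [c = 0], where [dg] vanishes, is not covered by
   [dg_le0]. *)
have dgc : dg c <= 0.
  move: c0; rewrite le_eqVlt => /predU1P[<-|/dg_le0//].
  by rewrite /dg scale0r addr0 subrr mul0r subr0.
move=> h; move: dgc; rewrite -h; lra.
Qed.

(** Descent along [- eta *: g], where the inner product of [g] and the gradient is replaced by
    polarisation: twice that product is the sum of the two squared norms minus the squared
    estimation error. *)
Lemma gradient_step_descent (f : 'rV[R]_d -> R) (L eta : R) x g : 0 < L ->
  (forall z, differentiable f z) ->
  (forall z z', sqnorm (grad f z - grad f z') <= L ^+ 2 * sqnorm (z - z')) ->
  f (x - eta *: g) + eta / 2 * sqnorm (grad f x) +
    eta / 2 * (1 - L * eta) * sqnorm g <=
  f x + eta / 2 * sqnorm (g - grad f x).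
Proof.
move=> L0 fd fL; have := smooth_descent x (x - eta *: g) L0 fd fL.
rewrite (_ : x - eta *: g - x = (- eta) *: g); last by rewrite addrC addKr scaleNr.
rewrite dotZr sqnormZ sqnormB.
rewrite (_ : dot g (grad f x) = dot (grad f x) g); first nra.
by apply: eq_bigr => j _; rewrite mulrC.
Qed.

End euclidean.

(** * Second moments of random vectors *)

Lemma measurable_sqnorm {R : realType} {d : nat} {dT : measure_display}
    {T : measurableType dT} (Y : T -> 'rV[R]_d) :
  (forall k, measurable_fun setT (fun w => Y w ord0 k)) ->
  measurable_fun setT (fun w => sqnorm (Y w)).
Proof. by move=> mY; apply: measurable_sum => k; exact: measurable_funX. Qed.

Section second_moments.
Local Open Scope ereal_scope.
Context {R : realType} {d : nat} {dZ : measure_display} {Z : measurableType dZ}.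
Variable D : probability Z R.
Variables (Y : Z -> 'rV[R]_d) (m : 'rV[R]_d) (B : R).
Hypothesis Y_int : forall k, D.-integrable setT (fun z => (Y z ord0 k)%:E).
Hypothesis Y_mean : forall k, \int[D]_z (Y z ord0 k)%:E = (m ord0 k)%:E.
Hypothesis Y_sq : \int[D]_z (sqnorm (Y z))%:E <= B%:E.

(** Expanding the square leaves a cross term that sees only the mean. It is used with [a = - m] and
    [c = 1] for variance and Jensen, and with [m = 0] to add a centred draw. *)
Lemma integral_sqnorm_affine (a : 'rV[R]_d) (c : R) :
  \int[D]_z (sqnorm (a + c *: Y z))%:E =
  (sqnorm a + 2 * (c * dot a m))%:E + (c ^+ 2)%:E * \int[D]_z (sqnorm (Y z))%:E.
Proof.
have mY k : measurable_fun setT (fun z => Y z ord0 k).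
  by apply/measurable_EFinP; exact: measurable_int (Y_int k).
have iS : D.-integrable setT (fun z => (sqnorm (Y z))%:E).
  apply/integrableP; split; first exact/measurable_EFinP/measurable_sqnorm.
  under eq_integral do rewrite gee0_abs ?lee_fin ?sqnorm_ge0//.
  by apply: le_lt_trans Y_sq _; rewrite ltry.
have iL k : D.-integrable setT (fun z => ((2 * (c * a ord0 k)) * Y z ord0 k)%:E).
  by under eq_fun do rewrite EFinM; exact: integrableZl.
have E z : (sqnorm (a + c *: Y z))%:E = (sqnorm a)%:E +
    (\sum_k ((2 * (c * a ord0 k)) * Y z ord0 k)%:E + (c ^+ 2)%:E * (sqnorm (Y z))%:E).
  rewrite sumEFin -EFinM -!EFinD sqnormD sqnormZ dotZr; congr EFin.
  rewrite [RHS]addrA [LHS]addrAC; congr (_ + _ + _)%R.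
  by rewrite /dot !mulr_sumr; apply: eq_bigr => k _; ring.
under eq_integral do rewrite E.
rewrite integralD//=; last 2 first.
- exact: finite_measure_integrable_cst.
- by apply: integrableD => //; [exact: integrable_sum|exact: integrableZl].
rewrite integralD//=; [|exact: integrable_sum|exact: integrableZl].
rewrite integral_cst//= probability_setT mule1 integralZl//.
rewrite addeA; congr (_ + _); rewrite EFinD; congr (_ + _).
rewrite integral_sum//= /dot !mulr_sumr -sumEFin; apply: eq_bigr => k _.
under eq_integral do rewrite EFinM.
by rewrite integralZl// Y_mean -EFinM; congr EFin; ring.
Qed.

(** The variance is the second moment minus [sqnorm m]. *)
Lemma integral_sqnorm_centered :
  \int[D]_z (sqnorm (Y z - m))%:E <= B%:E.
Proof.
under eq_integral => z _ do rewrite -[Y z]scale1r addrC.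
rewrite integral_sqnorm_affine expr1n mul1e mul1r.
apply: le_trans Y_sq; rewrite -[leRHS]add0e leeD2r// lee_fin.
have -> : dot (- m) m = (- sqnorm m)%R.
  by rewrite /dot /sqnorm -sumrN; apply: eq_bigr => j _; rewrite mxE; ring.
by rewrite -scaleN1r sqnormZ; have := sqnorm_ge0 m; lra.
Qed.

(** Jensen for the squared norm, read off from the nonnegativity of the variance. *)
Lemma sqnorm_mean_le : (sqnorm m <= B)%R.
Proof.
have : 0 <= \int[D]_z (sqnorm (- m + 1%R *: Y z))%:E.
  by apply: integral_ge0 => z _; rewrite lee_fin sqnorm_ge0.
rewrite integral_sqnorm_affine expr1n mul1e mul1r.
have -> : dot (- m) m = (- sqnorm m)%R.
  by rewrite /dot /sqnorm -sumrN; apply: eq_bigr => j _; rewrite mxE; ring.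
have -> : (sqnorm (- m) + 2 * - sqnorm m = - sqnorm m)%R.
  by rewrite -scaleN1r sqnormZ; ring.
move=> h; have := le_trans h (leeD2l (- sqnorm m)%:E Y_sq).
by rewrite -EFinD lee_fin addrC subr_ge0.
Qed.

End second_moments.

(** * Independence of the past and a fresh source *)

Section freezing.
Context {R : realType} {dO : measure_display} {Omega : measurableType dO}.
Variable P : probability Omega R.
Context {J : eqType} (G : J -> set (set Omega)).
Hypothesis Gm : forall i, G i `<=` measurable.
Hypothesis GT : forall i, G i setT.
Hypothesis GI : forall i, setI_closed (G i).
Hypothesis Gindep : mutually_independent P G.

(** The pi-system on which [mutually_independent] gives the product rule directly; the lists are
    duplicate-free to match its form. *)
Definition cylinder (S : pred J) : set (set Omega) :=
  [set A | exists s E, [/\ uniq s, {subset s <= S},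
     forall i, i \in s -> G i (E i) & A = \big[setI/setT]_(i <- s) E i]].

(* [Omega] itself, equipped with the sigma-algebra generated by the sources in [S]. *)
Definition pastType (S : pred J) : measurableType _ := g_sigma_algebraType (cylinder S).

Lemma bigsetI_seqE (s : seq J) (E : J -> set Omega) w :
  (\big[setI/setT]_(i <- s) E i) w <-> forall i, i \in s -> E i w.
Proof.
elim: s => [|i s IH]; first by rewrite big_nil.
rewrite big_cons; split.
  by move=> [Ei /IH Es] j; rewrite inE => /predU1P[->//|/Es].
move=> h; split; first by apply: h; rewrite mem_head.
by apply/IH => j js; apply: h; rewrite inE js orbT.
Qed.

Lemma bigsetI_measurable (s : seq J) (E : J -> set Omega) :
  (forall i, i \in s -> G i (E i)) -> measurable (\big[setI/setT]_(i <- s) E i).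
Proof.
move=> sE; rewrite big_seq; apply: (big_ind measurable) => //.
  by move=> ? ?; exact: measurableI.
by move=> i /sE /Gm.
Qed.

Lemma cylinder_measurable S : cylinder S `<=` measurable.
Proof. by move=> _ [s [E [_ _ sE ->]]]; exact: bigsetI_measurable. Qed.

Lemma cylinderT S : cylinder S setT.
Proof. by exists [::], (fun=> setT); rewrite big_nil; split. Qed.

(** The two lists are merged without duplicates. A source present in both contributes the
    intersection of its two events, and [setT] stands in wherever a source is missing from one of
    them. *)
Lemma cylinderI S : setI_closed (cylinder S).
Proof.
move=> _ _ [s [E [us sS sE ->]]] [s' [E' [us' sS' sE' ->]]].
exists (undup (s ++ s')),
  (fun i => (if i \in s then E i else setT) `&` (if i \in s' then E' i else setT)).
split.
- exact: undup_uniq.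
- by move=> i; rewrite mem_undup mem_cat => /orP[/sS|/sS'].
- move=> i _; apply: GI.
    by case: ifP => // /sE.
  by case: ifP => // /sE'.
- apply/seteqP; split=> w; rewrite bigsetI_seqE.
  + move=> [/bigsetI_seqE h /bigsetI_seqE h'] i _.
    by split; case: ifP => // ?; [apply: h|apply: h'].
  + move=> h; split; apply/bigsetI_seqE => i si.
      by have [] := h i; rewrite ?mem_undup ?mem_cat ?si.
    by have [] := h i; rewrite ?mem_undup ?mem_cat ?si ?orbT.
Qed.

Lemma past_measurable S (A : set Omega) :
  measurable (A : set (pastType S)) -> measurable A.
Proof.
by apply: smallest_sub; [exact: sigma_algebra_measurable|exact: cylinder_measurable].
Qed.

Lemma event_past (S : pred J) i A : S i -> G i A ->
  measurable (A : set (pastType S)).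
Proof.
move=> Si GiA; apply: sub_sigma_algebra; exists [:: i], (fun=> A).
split=> //.
- by move=> j; rewrite inE => /eqP ->.
- by move=> j; rewrite inE => /eqP ->.
- by rewrite big_seq1.
Qed.

Lemma past_sub (S S' : pred J) (A : set Omega) : subpred S S' ->
  measurable (A : set (pastType S)) -> measurable (A : set (pastType S')).
Proof.
move=> SS'; apply: smallest_sub; first exact: sigma_algebra_measurable.
move=> _ [s [E [us sS sE ->]]]; apply: sub_sigma_algebra; exists s, E; split => //.
by move=> i /sS /SS'.
Qed.

(** Uniqueness of measures on a pi-system: [C] to [P B * P C] and [C] to [P (C /\ B)] are finite
    measures that agree on [cylinder S], by independence of the list [j :: s], hence on the
    generated sigma-algebra. *)
Lemma past_indep S j A B : j \notin S -> measurable (A : set (pastType S)) ->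
  G j B -> (P (A `&` B) = P A * P B)%E.
Proof.
move=> jS mA GjB.
have mB : measurable B by exact: Gm GjB.
have PB_ge0 : 0 <= fine (P B) by rewrite fine_ge0.
have PBE : (P B = (fine (P B))%:E)%E by rewrite fineK// fin_num_measure.
have cov : \bigcup_(k : nat) [set: Omega] = setT by rewrite bigcup_const//; exists 0%N.
have mscaleE C : mscale (NngNum PB_ge0) P C = (P B * P C)%E by rewrite [X in (X * _)%E]PBE.
transitivity (mscale (NngNum PB_ge0) P A); last by rewrite mscaleE muleC.
apply/esym; apply: (@g_sigma_algebra_measure_unique _ _ _ (cylinder S)
  (@cylinder_measurable S) (fun=> setT) (fun=> cylinderT S) cov
  (mscale (NngNum PB_ge0) P) (mrestr P mB) (@cylinderI S) _ _ A mA).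
- move=> _ [s [E [us sS sE ->]]].
  have mE : measurable (\big[setI/setT]_(i <- s) E i) by exact: bigsetI_measurable.
  transitivity (P B * P (\big[setI/setT]_(i <- s) E i))%E; first exact: mscaleE.
  transitivity (P (\big[setI/setT]_(i <- s) E i `&` B)); last by [].
  have js : j \notin s by apply: contra jS => /sS.
  have := @Gindep (j :: s) (fun i => if i == j then B else E i).
  rewrite /= js us !big_cons eqxx => /(_ isT) h.
  rewrite setIC.
  have eqE : \big[setI/setT]_(i <- s) (if i == j then B else E i) =
      \big[setI/setT]_(i <- s) E i.
    by rewrite big_seq [RHS]big_seq; apply: eq_bigr => i si; case: eqP si => // ->; rewrite (negbTE js).
  rewrite -eqE h; last first.
    by move=> i; rewrite inE; case: eqP => [-> _//|_ /=]; exact: sE.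
  congr (_ * _)%E.
  rewrite (eq_big_seq (fun i => P (E i))); last first.
    by move=> i si; case: eqP si => // ->; rewrite (negbTE js).
  by rewrite eqE (@Gindep s E).
- move=> k; apply: (@le_lt_trans _ _ (P B * P setT)%E); first by rewrite -mscaleE.
  by rewrite probability_setT mule1 PBE ltry.
Qed.

Lemma past_fun_measurable S d' (T' : measurableType d') (h : Omega -> T') :
  measurable_fun setT (h : pastType S -> T') -> measurable_fun setT h.
Proof.
by move=> mh _ B mB; apply: (@past_measurable S); exact: mh.
Qed.

Lemma past_fun_sub (S S' : pred J) d' (T' : measurableType d') (h : Omega -> T') :
  subpred S S' -> measurable_fun setT (h : pastType S -> T') ->
  measurable_fun setT (h : pastType S' -> T').
Proof.
by move=> SS' mh _ B mB; apply: (past_sub SS'); exact: mh.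
Qed.

Lemma past_source_measurable (S : pred J) j d' (T' : measurableType d') (X : Omega -> T') :
  S j -> G j = preimage_set_system setT X measurable ->
  measurable_fun setT (X : pastType S -> T').
Proof.
by move=> Sj GjE _ B mB; apply: (event_past Sj); rewrite GjE; exists B.
Qed.

(** The substitute for conditional expectation given the past. By [past_indep] the pair formed by
    the past and [X] has a product law on rectangles, so everywhere, and Tonelli integrates over [X]
    first. *)
Lemma integral_freeze S j d' (T' : measurableType d') (X : {RV P >-> T'})
    (D : probability T' R) (h : pastType S * T' -> \bar R) :
  j \notin S -> G j = preimage_set_system setT X measurable ->
  (forall A, measurable A -> distribution P X A = D A) ->
  measurable_fun setT h -> (forall u, (0 <= h u)%E) ->
  (\int[P]_w h (w, X w) = \int[P]_w \int[D]_z h (w, z))%E.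
Proof.
move=> jS GjE XD mh h0.
(* The identity on points, but its target carries the smaller sigma-algebra; its law [P1] is the
   restriction of [P] to the events of the past. *)
pose phi : Omega -> pastType S := id.
have mphi : measurable_fun setT phi.
  by move=> _ A mA; rewrite setTI; exact: (@past_measurable S).
pose phi' : {mfun Omega >-> pastType S} :=
  HB.pack phi (isMeasurableFun.Build _ _ _ _ phi mphi).
pose P1 := distribution P phi'.
pose psi : Omega -> pastType S * T' := fun w => (phi w, X w).
have mpsi : measurable_fun setT psi by apply/measurable_fun_pairP; split.
pose psi' : {mfun Omega >-> (pastType S * T')%type} :=
  HB.pack psi (isMeasurableFun.Build _ _ _ _ psi mpsi).
have prodE A : measurable A -> (P1 \x D)%E A = distribution P psi' A.
  apply: product_measure_unique => A1 B mA1 mB.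
  transitivity (P A1 * distribution P X B)%E; last by rewrite XD.
  transitivity (P (A1 `&` X @^-1` B)); first by [].
  by apply: (@past_indep S j) => //; rewrite GjE; exists B => //; rewrite setTI.
transitivity (\int[distribution P psi']_u h u)%E.
  by rewrite ge0_integral_distribution.
transitivity (\int[(P1 \x D)%E]_u h u)%E.
  apply: eq_measure_integral => A mA _; exact: (esym (prodE A mA)).
rewrite fubini_tonelli1// /fubini_F /P1 ge0_integral_distribution//.
- exact: measurable_fun_fubini_tonelli_F.
- by move=> y; exact: integral_ge0.
Qed.

Lemma past_pair_measurable (S S' : pred J) d' d'' (T' : measurableType d')
    (T'' : measurableType d'') (X : Omega -> T') (h : pastType S * T' -> T'') :
  subpred S S' -> measurable_fun setT (X : pastType S' -> T') ->
  measurable_fun setT h ->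
  measurable_fun setT ((fun w => h (w, X w)) : pastType S' -> T'').
Proof.
move=> SS' mX mh.
have mpair : measurable_fun setT ((fun w => (w, X w)) : pastType S' -> pastType S * T').
  apply/measurable_fun_pairP; split=> //.
  by move=> _ A mA; rewrite setTI; exact: (past_sub SS').
exact: (measurableT_comp mh mpair).
Qed.

Section draws.
Context {d : nat} {dZ : measure_display} {Z : measurableType dZ}.
Variables (D : probability Z R) (S : pred J).
Variables (xi : Omega -> Z -> 'rV[R]_d) (B : Omega -> R) (c : R).
Hypothesis mxi : forall k,
  measurable_fun setT ((fun u => xi u.1 u.2 ord0 k) : pastType S * Z -> R).
Hypothesis mB : measurable_fun setT (B : pastType S -> R).
Hypothesis xi_int : forall w k, D.-integrable setT (fun z => (xi w z ord0 k)%:E).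
Hypothesis xi_mean : forall w k, (\int[D]_z (xi w z ord0 k)%:E = 0)%E.
Hypothesis xi_sq : forall w, (\int[D]_z (sqnorm (xi w z))%:E <= (B w)%:E)%E.

Let B_ge0 w : 0 <= B w.
Proof.
rewrite -lee_fin; apply: le_trans (xi_sq w).
by apply: integral_ge0 => z _; rewrite lee_fin sqnorm_ge0.
Qed.

(** With everything in [S'] frozen, [U] is a constant vector and the draw is centred, so the cross
    term vanishes and the draw adds at most [c ^+ 2 * B]. *)
Lemma integral_add_draw (S' : pred J) j (X : {RV P >-> Z}) (U : Omega -> 'rV[R]_d) :
  subpred S S' -> j \notin S' -> G j = preimage_set_system setT X measurable ->
  (forall A, measurable A -> distribution P X A = D A) ->
  (forall k, measurable_fun setT ((fun w => U w ord0 k) : pastType S' -> R)) ->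
  (\int[P]_w (sqnorm (U w + c *: xi w (X w)))%:E <=
   \int[P]_w (sqnorm (U w))%:E + (c ^+ 2)%:E * \int[P]_w (B w)%:E)%E.
Proof.
move=> SS' jS' GjE XD mU.
have mxi' k : measurable_fun setT ((fun u => xi u.1 u.2 ord0 k) : pastType S' * Z -> R).
  have mpair : measurable_fun setT ((fun u => u) : pastType S' * Z -> pastType S * Z).
    apply/measurable_fun_pairP; split; last exact: measurable_snd.
    have mid : measurable_fun setT (id : pastType S' -> pastType S).
      by move=> _ A mA; rewrite setTI; exact: (past_sub SS').
    exact: (measurableT_comp mid measurable_fst).
  exact: (measurableT_comp (mxi k) mpair).
have mB' := past_fun_measurable mB.
have mU' k := past_fun_measurable (mU k).
pose h (u : pastType S' * Z) := (sqnorm (U u.1 + c *: xi u.1 u.2))%:E.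
have h0 u : (0 <= h u)%E by rewrite lee_fin sqnorm_ge0.
have mh : measurable_fun setT h.
  apply/measurable_EFinP; apply: measurable_sqnorm => k.
  under eq_fun do rewrite !mxE.
  apply: measurable_funD; last by apply: measurable_funM => //; exact: mxi'.
  by apply: (measurableT_comp (mU k)); exact: measurable_fst.
rewrite (@integral_freeze S' j _ _ X D h)//.
rewrite -ge0_integralZl//; last 3 first.
- exact/measurable_EFinP.
- by move=> w _; rewrite lee_fin.
- by rewrite lee_fin sqr_ge0.
rewrite -ge0_integralD//=; last 4 first.
- by move=> w _; rewrite lee_fin sqnorm_ge0.
- exact/measurable_EFinP/measurable_sqnorm.
- by move=> w _; rewrite -EFinM lee_fin mulr_ge0// sqr_ge0.
- by apply: measurable_funeM; exact/measurable_EFinP.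
apply: ge0_le_integral => //=.
- by move=> w _; exact: integral_ge0.
- apply: (@past_fun_measurable S').
  exact: (@measurable_fun_fubini_tonelli_F _ _ _ _ _ D h).
- apply: emeasurable_funD; first exact/measurable_EFinP/measurable_sqnorm.
  by apply: measurable_funeM; exact/measurable_EFinP.
- move=> w _; rewrite /h/=.
  rewrite (@integral_sqnorm_affine _ _ _ _ D (xi w) 0 (B w))//; last first.
    by move=> k; rewrite xi_mean mxE.
  rewrite [dot _ _]big1 ?mulr0 ?addr0; last by move=> k _; rewrite mxE mulr0.
  by apply: leeD2l; apply: lee_wpmul2l; rewrite ?lee_fin ?sqr_ge0.
Qed.

(* A fresh draw is centred given the past, so revealing the draws one at a time makes
   the cross terms vanish. *)
Lemma integral_add_draws (I : eqType) (src : I -> J) (X : I -> {RV P >-> Z})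
    (s : seq I) (U : Omega -> 'rV[R]_d) :
  (forall i, src i \notin S) -> injective src -> uniq s ->
  (forall i, G (src i) = preimage_set_system setT (X i) measurable) ->
  (forall i A, measurable A -> distribution P (X i) A = D A) ->
  (forall k, measurable_fun setT ((fun w => U w ord0 k) : pastType S -> R)) ->
  (\int[P]_w (sqnorm (U w + c *: \sum_(i <- s) xi w (X i w)))%:E <=
   \int[P]_w (sqnorm (U w))%:E +
     ((size s)%:R * c ^+ 2)%:E * \int[P]_w (B w)%:E)%E.
Proof.
move=> srcS src_inj us GE XD mU.
elim: s us => [_|i s IH /= /andP[iNs us]].
  rewrite /= mul0r mul0e adde0.
  by under eq_integral do rewrite big_nil scaler0 addr0.
under eq_integral do rewrite big_cons [X in _ *: X]addrC scalerDr addrA.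
(* The head of the list is revealed last: its past is [S] together with the sources of the tail, and
   [uniq] keeps it fresh. *)
pose S' := [pred j | S j || (j \in map src s)].
have SS' : subpred S S' by move=> j Sj; rewrite /= Sj.
apply: le_trans (@integral_add_draw S' (src i) (X i) _ SS' _ _ _ _) _ => //.
- by rewrite inE/= negb_or (mem_map src_inj) iNs andbT; exact: srcS.
- exact: XD.
- move=> k; under eq_fun do rewrite mxE mxE summxE.
  apply: measurable_funD; first exact: past_fun_sub (mU k).
  apply: measurable_funM => //.
  under eq_fun do rewrite big_tnth.
  apply: measurable_sum => l.
  apply: (past_pair_measurable SS' _ (mxi k)).
  apply: (past_source_measurable _ (GE _)).
  by rewrite /= map_f ?orbT// mem_tnth.
have c2 : 0 <= c ^+ 2 by exact: sqr_ge0.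
have sc2 : 0 <= (size s)%:R * c ^+ 2 by exact: mulr_ge0.
rewrite -natr1 mulrDl mul1r EFinD ge0_muleDl ?lee_fin//.
by rewrite addeA leeD2r// IH.
Qed.

End draws.

End freezing.

(** * Discrete laws *)

Section atomic_measures.
Local Open Scope ereal_scope.
Context {R : realType} {dT : measure_display} {T : measurableType dT}.

(** The listed atoms already carry mass one, so the complement is negligible. This covers laws
    prescribed only on some points, such as that of [out] below [T]. *)
Lemma integral_finite_support (mu : probability T R) (g : T -> \bar R) (s : seq T) :
  uniq s -> (forall x, measurable [set x : T]) -> \sum_(x <- s) mu [set x] = 1 ->
  measurable_fun setT g -> (forall x, 0 <= g x) ->
  \int[mu]_x g x = \sum_(x <- s) g x * mu [set x].
Proof.
move=> us m1 s1 mg g0.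
pose A := \big[setU/set0]_(x <- s) [set x].
have mA : measurable A by exact: bigsetU_measurable.
have tA : trivIset [set` s] (fun x : T => [set x]).
  by move=> i j _ _ [x [-> ->]].
have muA : mu A = 1.
  rewrite -[mu A]mul1e -integral_cst// ge0_integral_bigsetU//.
  by rewrite -[RHS]s1; apply: eq_bigr => x _; rewrite integral_cst// mul1e.
have muAC : mu (~` A) = 0 by rewrite probability_setC// muA subee.
rewrite (@ge0_negligible_integral _ _ _ mu setT (~` A))//; last exact: measurableC.
rewrite setTD setCK ge0_integral_bigsetU//; last exact: measurable_funTS.
apply: eq_bigr => x _.
rewrite (eq_integral (cst (g x))); last by move=> y; rewrite inE => /= ->.
by rewrite integral_cst.
Qed.

(** The measure is a scaled sum of Dirac masses indexed by positions in the list, so repeated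
    elements count with multiplicity. A signed [g] is treated through its positive and negative
    parts. *)
Lemma integral_empirical (D : probability T R) (zs : seq T) (g : T -> R) :
  population D (Some zs) -> measurable_fun setT g ->
  \int[D]_z (g z)%:E = ((size zs)%:R^-1 * \sum_(z <- zs) g z)%:E.
Proof.
move=> [zs0 DE] mg.
have [z0 _] : exists z : T, True by case: (zs) zs0 => // z; exists z.
pose n := size zs.
have n0 : (0 <= n%:R^-1 :> R)%R by rewrite invr_ge0.
pose nu := mscale (NngNum n0) (msum (fun k => \d_(nth z0 zs k)) n).
have nuE A : measurable A -> D A = nu A.
  move=> mA; rewrite DE// /nu /mscale/= /msum EFinM; congr (_ * _).
  rewrite -sumEFin (big_nth z0) big_mkord.
  by apply: eq_bigr => i _. 
have key (Y : T -> \bar R) : measurable_fun setT Y -> (forall z, 0 <= Y z) ->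
    \int[D]_z Y z = (n%:R^-1)%R%:E * \sum_(z <- zs) Y z.
  move=> mY Y0.
  rewrite (eq_measure_integral nu); last by move=> A mA _; exact: nuE.
  rewrite ge0_integral_mscale//= ge0_integral_measure_sum//.
  congr *%E; rewrite (big_nth z0) big_mkord; apply: eq_bigr => i _.
  by rewrite integral_dirac// diracT mul1e.
have mgE : measurable_fun setT (fun z => (g z)%:E) by exact/measurable_EFinP.
rewrite integralE !key//; [|exact: measurable_funeneg|exact: measurable_funepos].
have -> : \sum_(z <- zs) (fun z => (g z)%:E)^\+ z = (\sum_(z <- zs) Num.max (g z) 0)%:E.
  by rewrite -sumEFin; apply: eq_bigr => i _; rewrite funeposE EFin_max.
have -> : \sum_(z <- zs) (fun z => (g z)%:E)^\- z = (\sum_(z <- zs) Num.max (- g z) 0)%:E.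
  by rewrite -sumEFin; apply: eq_bigr => i _; rewrite funenegE EFin_max EFinN.
rewrite -!EFinM -EFinB -mulrBr -sumrB; congr (_ * _)%R%:E.
apply: eq_bigr => z _.
by case: (lerP (g z) 0) => ?; case: (lerP (- g z)%R 0) => ?; lra.
Qed.

End atomic_measures.

(** The scalar telescoping, with [a] the gap, [e] the error, [n] the squared gradient and [g] the
    squared estimator. The weight of [e] solves [w = eta / 2 + (1 - p) * w], so the error terms
    cancel from one step to the next, while the bound on [K] lets [k] absorb the [g] terms. Each
    step leaves [eta / 2 * V], and the initial error leaves [eta / 2 * V / p]. *)
Lemma lyapunov_sum {R : realType} (a e n g : nat -> R) (eta p V k K : R) (N : nat) :
  0 < eta -> 0 < p -> (1 - p) / p * K <= k ->
  (forall t, 0 <= a t) -> (forall t, 0 <= e t) -> (forall t, 0 <= g t) ->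
  (forall t, a t.+1 + eta / 2 * n t + eta / 2 * k * g t <= a t + eta / 2 * e t) ->
  (forall t, e t.+1 <= p * V + (1 - p) * (e t + K * g t)) -> e 0%N <= V ->
  eta / 2 * \sum_(t < N) n t <= a 0%N + eta / 2 * V / p + N%:R * (eta / 2 * V).
Proof.
move=> eta0 p0 kK a0 e0 g0 ha he e0V.
have eta2 : 0 < eta / 2 by rewrite divr_gt0.
(* The Lyapunov function is [a + eta / (2 p) * e]. *)
suff : a N + eta / 2 / p * e N + eta / 2 * \sum_(t < N) n t <=
    a 0%N + eta / 2 * V / p + N%:R * (eta / 2 * V).
  have : 0 <= eta / 2 / p * e N by rewrite mulr_ge0// divr_ge0 ?ltW.
  by have := a0 N; lra.
elim: N => [|N IH].
  rewrite big_ord0 mulr0 addr0 mul0r addr0 lerD2l.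
  by rewrite mulrAC ler_pM2r ?invr_gt0// ler_pM2l.
rewrite big_ord_recr/=; have -> : N.+1%:R = N%:R + 1 :> R by rewrite natr1.
have h1 := ha N.
have h2 : eta / 2 / p * e N.+1 <=
    eta / 2 * V + eta / 2 / p * e N - eta / 2 * e N + eta / 2 * ((1 - p) / p * K) * g N.
  have hp : 0 <= eta / 2 / p by rewrite divr_ge0 ?ltW.
  apply: le_trans (ler_wpM2l hp (he N)) _.
  rewrite le_eqVlt; apply/orP; left; apply/eqP.
  by field; rewrite gt_eqF.
have h3 : eta / 2 * ((1 - p) / p * K) * g N <= eta / 2 * k * g N.
  by rewrite ler_wpM2r// ler_pM2l.
lra.
Qed.

(** A preimage is a countable union of rectangles, one for each integer; this serves to evaluate the
    iterates at the random output index. *)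
Lemma measurable_fun_nat_param {d1 d2 : measure_display} {T1 : measurableType d1}
    {T2 : measurableType d2} (h : T1 -> nat -> T2) :
  (forall k, measurable_fun setT (h ^~ k)) ->
  measurable_fun setT (fun u : T1 * nat => h u.1 u.2).
Proof.
move=> mh _ B mB; rewrite setTI.
rewrite (_ : _ @^-1` _ = \bigcup_k ((h ^~ k @^-1` B) `*` [set k])); last first.
  apply/seteqP; split=> [[w k]/= Bk|[w k] [j _ [/= Bj ->]]//].
  by exists k.
apply: bigcupT_measurable => k; apply: measurableX => //.
by rewrite -[X in measurable X]setTI; exact: mh.
Qed.

(** * The PAGE iterates *)

Section random_variable_events.
Context {R : realType} {dO dT : measure_display} {Omega : measurableType dO}.
Context {T : measurableType dT} (P : probability Omega R) (X : {RV P >-> T}).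

Let events := preimage_set_system setT X (@measurable _ T).

Lemma rv_events_measurable : events `<=` measurable.
Proof. by move=> _ [B mB <-]; exact: (measurable_funP X). Qed.

Lemma rv_eventsT : events setT.
Proof. by exists setT => //; rewrite preimage_setT setTI. Qed.

Lemma rv_eventsI : setI_closed events.
Proof.
move=> _ _ [B mB <-] [C mC <-]; exists (B `&` C); first exact: measurableI.
by rewrite !setTI preimage_setI.
Qed.

End random_variable_events.

Lemma rowB {R : zmodType} {d : nat} (u v : 'rV[R]_d) k :
  (u - v) ord0 k = u ord0 k - v ord0 k.
Proof. by rewrite mxE [X in _ + X]mxE. Qed.

Lemma coin_law_false {R : realType} {dO dZ : measure_display} {Omega : measurableType dO}
    {Z : measurableType dZ} {P : probability Omega R} {D : probability Z R}
    {b b' : nat} {p : nat -> R} {T : nat} (r : page_randomness P D b b' p T) t :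
  distribution P (coin r t) [set false] = (1 - p t)%:E.
Proof.
rewrite (_ : [set false] = ~` [set true]); last first.
  by apply/seteqP; split=> [[]|[]]//=.
transitivity (1 - distribution P (coin r t) [set true])%E; last by rewrite coin_law.
exact: probability_setC.
Qed.

Section page_analysis.
Context {R : realType} {dO : measure_display} {Omega : measurableType dO}.
Context {dZ : measure_display} {Z : measurableType dZ}.
Context {P : probability Omega R} {D : probability Z R}.
Context {b b' : nat} {p : R} {T : nat} {d : nat}.
Variable r : page_randomness P D b b' (fun=> p) T.
Variables (pop : option (seq Z)) (F : Z -> 'rV[R]_d -> R) (f : 'rV[R]_d -> R).
Variables (x0 : 'rV[R]_d) (eta L V : R).

Definition page_events : source b b' -> set (set Omega) :=
  source_events (fun t j => draw r t j) (fun t j => draw' r t j)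
    (fun t => coin r t) (out r).

Definition src_draw (t : nat) (j : 'I_b) : source b b' := inl (inl (inl (t, j))).
Definition src_draw' (t : nat) (j : 'I_b') : source b b' := inl (inl (inr (t, j))).
Definition src_coin (t : nat) : source b b' := inl (inr t).
Definition src_out : source b b' := inr tt.

Lemma page_events_measurable i : page_events i `<=` measurable.
Proof. by case: i => [[[[t j]|[t j]]|t]|[]]; exact: rv_events_measurable. Qed.

Lemma page_eventsT i : page_events i setT.
Proof. by case: i => [[[[t j]|[t j]]|t]|[]]; exact: rv_eventsT. Qed.

Lemma page_eventsI i : setI_closed (page_events i).
Proof. by case: i => [[[[t j]|[t j]]|t]|[]]; exact: rv_eventsI. Qed.

Let page_indep : mutually_independent P page_events.
Proof. exact: (@page_independence R dO Omega dZ Z P D b b' (fun=> p) T r). Qed.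

Let page_freeze := @integral_freeze R dO Omega P _ page_events
  page_events_measurable page_eventsT page_eventsI page_indep.

(* The sources used to compute the pair [(x^t, g^t)]. *)
Definition page_past (t : nat) : pred (source b b') := fun i =>
  match i with
  | inl (inl (inl (s, _))) => (s <= t)%N
  | inl (inl (inr (s, _))) => (s < t)%N
  | inl (inr s) => (s < t)%N
  | inr _ => false
  end.

Definition page_x t w := page_iterate pop F x0 eta r w t.

Definition page_g t w := (page_state F x0 eta
  (fun t => minibatch pop [seq draw r t j w | j <- enum 'I_b])
  (fun t => [seq draw' r t j w | j <- enum 'I_b'])
  (fun t => coin r t w) t).2.

Definition batch_grad t w x : 'rV[R]_d :=
  let I := minibatch pop [seq draw r t j w | j <- enum 'I_b] in
  (size I)%:R^-1 *: \sum_(z <- I) grad (F z) x.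

Definition batch_diff t w x y : 'rV[R]_d :=
  b'%:R^-1 *: \sum_(j <- enum 'I_b')
    (grad (F (draw' r t j w)) x - grad (F (draw' r t j w)) y).

Lemma page_xS t w : page_x t.+1 w = page_x t w - eta *: page_g t w.
Proof. by rewrite /page_x /page_g /page_iterate /=; case: (page_state _ _ _ _ _ _ t). Qed.

Lemma page_gS t w : page_g t.+1 w =
  if coin r t w then batch_grad t.+1 w (page_x t.+1 w)
  else page_g t w + batch_diff t w (page_x t.+1 w) (page_x t w).
Proof.
rewrite page_xS /page_x /page_g /page_iterate /=.
case: (page_state _ _ _ _ _ _ t) => x g /=; case: ifP => // _.
by rewrite size_map size_enum_ord big_map.
Qed.

Hypothesis b'_gt0 : (0 < b')%N.
Hypothesis b_gt0 : (0 < b)%N.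
Hypothesis L_gt0 : 0 < L.
Hypothesis F_obj : stochastic_objective D F f.
Hypothesis F_smooth : average_smooth D F L.
(* [V] bounds the variance of a minibatch gradient; with the full index set the gradient
   is exact and any [V >= 0] will do. *)
Hypothesis batchP : (forall t w x, batch_grad t w x = grad f x) \/
  (forall t w x, batch_grad t w x =
     b%:R^-1 *: \sum_(j <- enum 'I_b) grad (F (draw r t j w)) x) /\
  exists2 s, bounded_variance D F f s & s ^+ 2 / b%:R <= V.
Hypothesis V_ge0 : 0 <= V.

Let F_diff z x : differentiable (F z) x. Proof. by case: F_obj. Qed.
Let f_diff x : differentiable f x. Proof. by case: F_obj. Qed.
Let mF y : measurable_fun setT (F ^~ y).
Proof.
case: F_obj => _ /(_ y)[Fi _] _ _.
by apply/measurable_EFinP; exact: measurable_int Fi.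
Qed.

Let gF_int x k : D.-integrable setT (fun z => (grad (F z) x ord0 k)%:E).
Proof. by case: F_obj => _ _ _ /(_ x k)[]. Qed.
Let gF_mean x k : (\int[D]_z (grad (F z) x ord0 k)%:E = (grad f x ord0 k)%:E)%E.
Proof. by case: F_obj => _ _ _ /(_ x k)[_]; rewrite unlock. Qed.

Let gFB_int x y k :
  D.-integrable setT (fun z => ((grad (F z) x - grad (F z) y) ord0 k)%:E).
Proof.
by under eq_fun do rewrite rowB EFinB; apply: integrableB.
Qed.

Let gFB_mean x y k :
  (\int[D]_z ((grad (F z) x - grad (F z) y) ord0 k)%:E =
   ((grad f x - grad f y) ord0 k)%:E)%E.
Proof.
under eq_integral do rewrite rowB EFinB.
by rewrite integralB// !gF_mean rowB EFinB.
Qed.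

Let gFB_sq x y :
  (\int[D]_z (sqnorm (grad (F z) x - grad (F z) y))%:E <=
   (L ^+ 2 * sqnorm (x - y))%:E)%E.
Proof.
rewrite -enorm_sqr; have := F_smooth x y; rewrite unlock.
by under eq_integral do rewrite enorm_sqr.
Qed.

(** Average smoothness bounds a mean square, and Jensen passes the bound to the mean gradient
    difference; this is the smoothness that the descent lemma uses. *)
Lemma grad_lipschitz x y : sqnorm (grad f x - grad f y) <= L ^+ 2 * sqnorm (x - y).
Proof. exact: sqnorm_mean_le (gFB_int x y) (gFB_mean x y) (gFB_sq x y). Qed.

(** * Measurability of the iterates with respect to the past *)

Section past_measurability.
Variable S : pred (source b b').
Let past := pastType page_events S.

Definition past_vector (x : Omega -> 'rV[R]_d) : Prop :=
  forall k, measurable_fun setT ((fun w => x w ord0 k) : past -> R).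

Lemma past_vectorD x y : past_vector x -> past_vector y ->
  past_vector (fun w => x w + y w).
Proof. by move=> mx my k; under eq_fun do rewrite mxE; exact: measurable_funD. Qed.

Lemma past_vectorZ (a : R) x : past_vector x -> past_vector (fun w => a *: x w).
Proof. by move=> mx k; under eq_fun do rewrite mxE; exact: measurable_funM. Qed.

Lemma past_vectorB x y : past_vector x -> past_vector y ->
  past_vector (fun w => x w - y w).
Proof. by move=> mx my k; under eq_fun do rewrite rowB; exact: measurable_funB. Qed.

Lemma past_vector_sum (I : Type) (s : seq I) (x : I -> Omega -> 'rV[R]_d) :
  (forall i, past_vector (x i)) -> past_vector (fun w => \sum_(i <- s) x i w).
Proof.
by move=> mx k; under eq_fun do rewrite summxE; apply: measurable_sum => i; exact: mx.
Qed.

Lemma past_vector_grad x : past_vector x -> past_vector (fun w => grad f (x w)).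
Proof.
(* The deterministic [f] is treated as a family constant in its parameter. *)
move=> mx k; apply: (@measurable_grad R d _ _ past past (fun=> f) id x k) => //.
Qed.

Lemma past_joint x k : past_vector x ->
  measurable_fun setT ((fun u => x u.1 ord0 k) : past * Z -> R).
Proof. by move=> mx; apply: (measurableT_comp (mx k)); exact: measurable_fst. Qed.

Lemma past_joint_grad x k : past_vector x ->
  measurable_fun setT ((fun u => grad (F u.2) (x u.1) ord0 k) : past * Z -> R).
Proof.
move=> mx; apply: (@measurable_grad R d _ _ (past * Z)%type Z F snd (fun u => x u.1)) => //.
by move=> j; exact: past_joint.
Qed.

Lemma past_vector_grad_source i (X : {RV P >-> Z}) x : S i ->
  page_events i = preimage_set_system setT X measurable -> past_vector x ->
  past_vector (fun w => grad (F (X w)) (x w)).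
Proof.
move=> Si iE mx k; apply: (@measurable_grad R d _ _ past Z F X x k) => //.
exact: past_source_measurable Si iE.
Qed.

Lemma past_vector_batch_grad t x : (forall j, S (src_draw t j)) -> past_vector x ->
  past_vector (fun w => batch_grad t w (x w)).
Proof.
move=> St mx; case: batchP => [bE|[bE _]].
  by move=> k; under eq_fun do rewrite bE; exact: past_vector_grad.
move=> k; under eq_fun do rewrite bE; move: k; apply: past_vectorZ.
by apply: past_vector_sum => j; exact: (past_vector_grad_source (St j)).
Qed.

Lemma past_vector_batch_diff t x y : (forall j, S (src_draw' t j)) ->
  past_vector x -> past_vector y -> past_vector (fun w => batch_diff t w (x w) (y w)).
Proof.
move=> St mx my; apply: past_vectorZ; apply: past_vector_sum => j.
by apply: past_vectorB; exact: (past_vector_grad_source (St j)).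
Qed.

End past_measurability.
Lemma past_vector_sub (S S' : pred (source b b')) x :
  subpred S S' -> past_vector S x -> past_vector S' x.
Proof. by move=> SS' mx k; exact: past_fun_sub (mx k). Qed.

Lemma past_vector_cst (S : pred (source b b')) x : past_vector S (fun=> x).
Proof. by move=> k; exact: measurable_cst. Qed.

Lemma page_past_leq t : subpred (page_past t) (page_past t.+1).
Proof. by move=> [[[[s j]|[s j]]|s]|[]]//= h; apply: ltnW. Qed.

Lemma page_measurable t :
  past_vector (page_past t) (page_x t) /\ past_vector (page_past t) (page_g t).
Proof.
elim: t => [|t [mx mg]].
  split; first exact: past_vector_cst.
  by apply: past_vector_batch_grad => //; exact: past_vector_cst.
have mx1 : past_vector (page_past t.+1) (page_x t.+1).
  move=> k; under eq_fun do rewrite page_xS; move: k.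
  apply: past_vectorB; first exact: past_vector_sub (@page_past_leq t) mx.
  by apply: past_vectorZ; exact: past_vector_sub (@page_past_leq t) mg.
split=> // k.
under eq_fun do rewrite page_gS fun_if if_arg if_arg.
apply: measurable_fun_ifT.
- by apply: (@past_source_measurable _ _ _ page_events _ (src_coin t)) => //=.
- by apply: past_vector_batch_grad => //=.
- move: k; apply: past_vectorD; first exact: past_vector_sub (@page_past_leq t) mg.
  apply: past_vector_batch_diff => //=.
  exact: past_vector_sub (@page_past_leq t) mx.
Qed.

(** One step better than [page_measurable t.+1]: the new point is fixed before the coin and the
    minibatches of its update are revealed, so these are fresh when gradients are taken there. *)
Lemma page_xS_measurable t : past_vector (page_past t) (page_x t.+1).
Proof.
have [mx mg] := page_measurable t.
move=> k; under eq_fun do rewrite page_xS; move: k.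
by apply: past_vectorB => //; exact: past_vectorZ.
Qed.

Lemma past_vector_measurable S x k : past_vector S x ->
  measurable_fun setT (fun w => x w ord0 k).
Proof.
by move=> mx; exact: (past_fun_measurable page_events_measurable (mx k)).
Qed.

(** * Recursion for the estimation error *)

Local Open Scope ereal_scope.

(** In the sampled case the error is an average of [b] draws, each centred given the past; adding
    them to [U = 0] leaves [s ^+ 2 / b%:R]. *)
Lemma batch_error S t x : (forall j, src_draw t j \notin S) -> past_vector S x ->
  \int[P]_w (sqnorm (batch_grad t w (x w) - grad f (x w)))%:E <= V%:E.
Proof.
move=> St mx; case: batchP => [bE|[bE [s Fs sV]]].
  under eq_integral do rewrite bE subrr sqnorm0.
  by rewrite integral0 lee_fin.
pose xi w z := (grad (F z) (x w) - grad f (x w))%R.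
have bE' w : (batch_grad t w (x w) - grad f (x w) =
    0 + b%:R^-1 *: \sum_(j <- enum 'I_b) xi w (draw r t j w))%R.
  rewrite add0r bE sumrB scalerBr [X in (_ - _ *: X)%R]big_const_seq count_predT size_enum_ord iter_addr_0.
  by rewrite -[X in (_ - _ *: X)%R]scaler_nat scalerA mulVf ?scale1r// pnatr_eq0 -lt0n.
under eq_integral do rewrite bE'.
apply: le_trans (@integral_add_draws _ _ _ P _ page_events page_events_measurable
  page_eventsT page_eventsI page_indep
  d _ Z D S xi (fun=> s ^+ 2)%R b%:R^-1 _ _ _ _ _
  _ (src_draw t) (fun j => draw r t j) (enum 'I_b) (fun=> 0%R) _ _ _ _ _ _) _ => //.
- move=> k; under eq_fun do rewrite rowB.
  apply: measurable_funB; first exact: past_joint_grad.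
  apply: (@past_joint S (fun w => grad f (x w)) k).
  exact: past_vector_grad.
- move=> w k; under eq_fun do rewrite rowB EFinB.
  by apply: integrableB => //; exact: finite_measure_integrable_cst.
- move=> w k; under eq_integral do rewrite rowB EFinB.
  rewrite integralB//; last exact: finite_measure_integrable_cst.
  by rewrite gF_mean integral_cst//= probability_setT mule1 subee.
- move=> w; have := Fs (x w); rewrite unlock.
  by under eq_integral do rewrite enorm_sqr.
- by move=> i j [].
- exact: enum_uniq.
- by move=> i A mA; exact: draw_law.
- under eq_integral do rewrite sqnorm0.
  rewrite integral0 add0e integral_cst//= probability_setT mule1 -EFinM lee_fin.
  apply: le_trans sV; rewrite size_enum_ord expr2 mulrA divff ?mul1r 1?mulrC//.
  by rewrite pnatr_eq0 -lt0n.
Qed.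

(** The new error is the old one, known from the past, plus an average of [b'] centred gradient
    differences. Each has conditional second moment at most [L ^+ 2] times the squared displacement,
    and the displacement is [- eta *: page_g t w]. *)
Lemma diff_error t :
  \int[P]_w (sqnorm (page_g t w + batch_diff t w (page_x t.+1 w) (page_x t w)
     - grad f (page_x t.+1 w)))%:E <=
  \int[P]_w (sqnorm (page_g t w - grad f (page_x t w)))%:E +
  (L ^+ 2 * eta ^+ 2 / b'%:R)%:E * \int[P]_w (sqnorm (page_g t w))%:E.
Proof.
have [mx mg] := page_measurable t; have mx1 := @page_xS_measurable t.
pose S := page_past t.
pose a w := (grad f (page_x t.+1 w) - grad f (page_x t w))%R.
pose xi w z := (grad (F z) (page_x t.+1 w) - grad (F z) (page_x t w) - a w)%R.
pose B w := (L ^+ 2 * eta ^+ 2 * sqnorm (page_g t w))%R.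
have bE w : (page_g t w + batch_diff t w (page_x t.+1 w) (page_x t w)
     - grad f (page_x t.+1 w) = (page_g t w - grad f (page_x t w)) +
     b'%:R^-1 *: \sum_(j <- enum 'I_b') xi w (draw' r t j w))%R.
  rewrite sumrB scalerBr [X in (_ - _ *: X)%R]big_const_seq count_predT.
  rewrite size_enum_ord iter_addr_0 -[X in (_ - _ *: X)%R]scaler_nat scalerA.
  rewrite mulVf ?scale1r ?pnatr_eq0 -?lt0n// /a -/(batch_diff t w _ _).
  by rewrite opprB [RHS]addrACA addKr.
under eq_integral do rewrite bE.
apply: le_trans (@integral_add_draws _ _ _ P _ page_events page_events_measurable
  page_eventsT page_eventsI page_indep
  d _ Z D S xi B b'%:R^-1 _ _ _ _ _
  _ (src_draw' t) (fun j => draw' r t j) (enum 'I_b') (fun w => page_g t w - grad f (page_x t w))%R _ _ _ _ _ _) _ => //.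
- move=> k; under eq_fun do rewrite rowB.
  apply: measurable_funB; last first.
    apply: (@past_joint S a k); apply: past_vectorB; exact: past_vector_grad.
  under eq_fun do rewrite rowB.
  by apply: measurable_funB; exact: past_joint_grad.
- by apply: measurable_funM => //; exact: measurable_sqnorm.
- move=> w k; under eq_fun do rewrite rowB EFinB.
  by apply: integrableB => //; exact: finite_measure_integrable_cst.
- move=> w k; under eq_integral do rewrite rowB EFinB.
  rewrite integralB//; last exact: finite_measure_integrable_cst.
  by rewrite gFB_mean integral_cst//= probability_setT mule1 subee.
- move=> w; apply: le_trans (integral_sqnorm_centered (gFB_int _ _) (gFB_mean _ _) (gFB_sq _ _)) _.
  rewrite lee_fin page_xS addrAC subrr add0r -scaleNr sqnormZ sqrrN mulrA.
  exact: lexx.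
- by move=> j; rewrite unfold_in /= ltnn.
- by move=> i j [].
- exact: enum_uniq.
- by move=> i A mA; exact: draw'_law.
- by apply: past_vectorB => //; exact: past_vector_grad.
- rewrite leeD2l// size_enum_ord expr2 mulrA divff ?mul1r; last by rewrite pnatr_eq0 -lt0n.
  under eq_integral do rewrite EFinM.
  rewrite ge0_integralZl//; last 3 first.
  + apply/measurable_EFinP/measurable_sqnorm => k; exact: past_vector_measurable mg.
  + by move=> w _; rewrite lee_fin sqnorm_ge0.
  + by rewrite lee_fin mulr_ge0 ?sqr_ge0.
  by rewrite muleA -EFinM mulrC.
Qed.

Let p_ge0 : (0 <= p)%R.
Proof. by rewrite -lee_fin -(coin_law r 0). Qed.

Let p_le1 : (p <= 1)%R.
Proof. by rewrite -lee_fin -(coin_law r 0); exact: probability_le1. Qed.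

(** The integrands involve the minibatches of the current update as well as the past, so everything
    except this one coin is frozen. *)
Lemma coin_split t (h1 h2 : Omega -> R) :
  let S := predC1 (src_coin t) in
  measurable_fun setT (h1 : pastType page_events S -> R) ->
  measurable_fun setT (h2 : pastType page_events S -> R) ->
  (forall w, 0 <= h1 w)%R -> (forall w, 0 <= h2 w)%R ->
  \int[P]_w (if coin r t w then h1 w else h2 w)%:E =
  p%:E * \int[P]_w (h1 w)%:E + (1 - p)%:E * \int[P]_w (h2 w)%:E.
Proof.
move=> S mh1 mh2 h10 h20.
pose h (u : pastType page_events S * bool) := (if u.2 then h1 u.1 else h2 u.1)%:E.
have mh : measurable_fun setT h.
  apply/measurable_EFinP; apply: measurable_fun_ifT => //.
  - by apply: (measurableT_comp mh1); exact: measurable_fst.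
  - by apply: (measurableT_comp mh2); exact: measurable_fst.
have h0 u : 0 <= h u by rewrite /h lee_fin; case: ifP.
have mh1' := past_fun_measurable page_events_measurable mh1.
have mh2' := past_fun_measurable page_events_measurable mh2.
pose mu : probability bool R := distribution P (coin r t).
have mu_t : mu [set true] = p%:E by exact: coin_law.
have mu_f : mu [set false] = (1 - p)%:E by exact: coin_law_false.
rewrite (@page_freeze S (src_coin t) _ _ (coin r t) mu h)//; last first.
  by rewrite inE /= eqxx.
under eq_integral => w _.
  rewrite (@integral_finite_support _ _ _ _ _ [:: true; false])//; last first.
    by rewrite !big_cons big_nil mu_t mu_f adde0 -EFinD addrC subrK.
  rewrite !big_cons big_nil mu_t mu_f adde0 /h/= muleC [X in _ + X]muleC.
  over.
rewrite /= ge0_integralD//=; last 4 first.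
- by move=> w _; rewrite -EFinM lee_fin mulr_ge0.
- by apply: measurable_funeM; exact/measurable_EFinP.
- by move=> w _; rewrite -EFinM lee_fin mulr_ge0// subr_ge0.
- by apply: measurable_funeM; exact/measurable_EFinP.
rewrite !ge0_integralZl//; try exact/measurable_EFinP.
- by move=> w _; rewrite lee_fin.
- by rewrite lee_fin subr_ge0.
- by move=> w _; rewrite lee_fin.
Qed.

Lemma page_past_coin t : subpred (page_past t) (predC1 (src_coin t)).
Proof.
move=> i; apply: contraTN => /eqP ->.
by rewrite /= ltnn.
Qed.

Lemma past_vector_sqnorm S x : past_vector S x ->
  measurable_fun setT ((fun w => sqnorm (x w)) : pastType page_events S -> R).
Proof. by move=> mx; exact: (@measurable_sqnorm _ _ _ (pastType page_events S)). Qed.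

Lemma measurable_past_sqnorm S x : past_vector S x ->
  measurable_fun setT (fun w => (sqnorm (x w))%:E).
Proof.
move=> mx; apply/measurable_EFinP/measurable_sqnorm => k.
exact: past_vector_measurable mx.
Qed.

Definition error_sq t := \int[P]_w (sqnorm (page_g t w - grad f (page_x t w)))%:E.
Definition step_sq t := \int[P]_w (sqnorm (page_g t w))%:E.
Definition grad_sq t := \int[P]_w (sqnorm (grad f (page_x t w)))%:E.

Lemma error_sqS t : error_sq t.+1 <=
  p%:E * V%:E + (1 - p)%:E *
    (error_sq t + (L ^+ 2 * eta ^+ 2 / b'%:R)%:E * step_sq t).
Proof.
have [mx mg] := page_measurable t; have mx1 := @page_xS_measurable t.
rewrite /error_sq.
have E w : sqnorm (page_g t.+1 w - grad f (page_x t.+1 w)) =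
  if coin r t w then sqnorm (batch_grad t.+1 w (page_x t.+1 w) - grad f (page_x t.+1 w))
  else sqnorm (page_g t w + batch_diff t w (page_x t.+1 w) (page_x t w)
     - grad f (page_x t.+1 w)).
  by rewrite page_gS; case: ifP.
under eq_integral do rewrite E.
have sub : subpred (page_past t) (predC1 (src_coin t)) := @page_past_coin t.
have mx' := past_vector_sub sub mx; have mx1' := past_vector_sub sub mx1.
have mg' := past_vector_sub sub mg.
rewrite coin_split; last 4 first.
- apply: past_vector_sqnorm; apply: past_vectorB; last exact: past_vector_grad.
  by apply: past_vector_batch_grad.
- apply: past_vector_sqnorm; apply: past_vectorB; last exact: past_vector_grad.
  by apply: past_vectorD => //; exact: past_vector_batch_diff.
- by move=> w; exact: sqnorm_ge0.
- by move=> w; exact: sqnorm_ge0.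
apply: leeD.
  apply: lee_wpmul2l; first by rewrite lee_fin.
  (* Applied with [page_past t]: the draws of index [t.+1] already belong to [page_past t.+1] and
     would not be fresh there. *)
  by apply: (@batch_error (page_past t)) => // j; rewrite unfold_in /= ltnn.
apply: lee_wpmul2l; first by rewrite lee_fin subr_ge0.
exact: diff_error.
Qed.

Lemma error_sq0 : error_sq 0 <= V%:E.
Proof.
apply: (@batch_error pred0 0 (fun=> x0)).
- by [].
- exact: past_vector_cst.
Qed.

(** Serves only to get finiteness of [step_sq]: its coefficient [1 - L * eta] in [gapS] may vanish,
    so [gapS] cannot provide it. *)
Lemma step_sq_le t : step_sq t <= 2%:E * error_sq t + 2%:E * grad_sq t.
Proof.
have [mx mg] := page_measurable t.
have me : measurable_fun setT
    (fun w => (sqnorm (page_g t w - grad f (page_x t w)))%:E).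
  apply: (@measurable_past_sqnorm (page_past t)).
  by apply: past_vectorB => //; exact: past_vector_grad.
have mn : measurable_fun setT (fun w => (sqnorm (grad f (page_x t w)))%:E).
  by apply: (@measurable_past_sqnorm (page_past t)); exact: past_vector_grad.
have ge0 (x : Omega -> 'rV[R]_d) w : [set: Omega] w -> 0 <= (sqnorm (x w))%:E.
  by rewrite lee_fin sqnorm_ge0.
rewrite -!ge0_integralZl//; try exact: ge0.
rewrite -ge0_integralD//=; last 4 first.
- by move=> w _; rewrite -EFinM lee_fin mulr_ge0 ?sqnorm_ge0.
- exact: measurable_funeM.
- by move=> w _; rewrite -EFinM lee_fin mulr_ge0 ?sqnorm_ge0.
- exact: measurable_funeM.
apply: ge0_le_integral => //.
- exact: ge0.
- exact: measurable_past_sqnorm mg.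
- by apply: emeasurable_funD; exact: measurable_funeM.
- move=> w _; rewrite -!EFinM -EFinD lee_fin.
  by rewrite -{1}[page_g t w](subrK (grad f (page_x t w))); exact: sqnormD_le.
Qed.

(** * Expected descent and finiteness of the moments *)

Variable xmin : 'rV[R]_d.
Hypothesis fmin : forall x, (f xmin <= f x)%R.
Hypothesis eta_gt0 : (0 < eta)%R.
Hypothesis L_eta : (L * eta <= 1)%R.

(** Subtracting the minimum makes the integrand nonnegative, so the integral behaves well before [f]
    is known to be integrable along the run. *)
Definition gap t := \int[P]_w (f (page_x t w) - f xmin)%:E.

Lemma measurable_gap t : measurable_fun setT (fun w => (f (page_x t w) - f xmin)%:E).
Proof.
apply/measurable_EFinP; apply: measurable_funB => //.
have [mx _] := page_measurable t.
apply: (@measurable_caratheodory R d _ _ Omega Omega (fun=> f) id (page_x t)) => //.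
- by move=> _ x; exact: differentiable_continuous.
- by move=> k; exact: past_vector_measurable mx.
Qed.

(** The pathwise inequality of [gradient_step_descent], integrated; with only nonnegative terms on
    both sides it is valid even for infinite integrals. *)
Lemma gapS t : gap t.+1 + (eta / 2)%:E * grad_sq t +
    (eta / 2 * (1 - L * eta))%:E * step_sq t <= gap t + (eta / 2)%:E * error_sq t.
Proof.
have [mx mg] := page_measurable t.
have eta2 : (0 <= eta / 2)%R by rewrite divr_ge0// ltW.
have c0 : (0 <= eta / 2 * (1 - L * eta))%R by rewrite mulr_ge0// subr_ge0.
have me : measurable_fun setT
    (fun w => (sqnorm (page_g t w - grad f (page_x t w)))%:E).
  apply: (@measurable_past_sqnorm (page_past t)).
  by apply: past_vectorB => //; exact: past_vector_grad.
have mn : measurable_fun setT (fun w => (sqnorm (grad f (page_x t w)))%:E).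
  by apply: (@measurable_past_sqnorm (page_past t)); exact: past_vector_grad.
have mgs := measurable_past_sqnorm mg.
have ge0 (x : Omega -> 'rV[R]_d) w : [set: Omega] w -> 0 <= (sqnorm (x w))%:E.
  by rewrite lee_fin sqnorm_ge0.
have cge0 (c : R) (v : 'rV[R]_d) : (0 <= c)%R -> 0 <= c%:E * (sqnorm v)%:E.
  by move=> ?; rewrite -EFinM lee_fin mulr_ge0 ?sqnorm_ge0.
have gge0 s w : [set: Omega] w -> 0 <= (f (page_x s w) - f xmin)%:E.
  by rewrite lee_fin subr_ge0.
have mgap := measurable_gap.
rewrite -!ge0_integralZl//; try exact: ge0.
have mn' : measurable_fun setT (fun w => (eta / 2)%:E * (sqnorm (grad f (page_x t w)))%:E).
  exact: measurable_funeM.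
have me' : measurable_fun setT (fun w => (eta / 2)%:E * (sqnorm (page_g t w - grad f (page_x t w)))%:E).
  exact: measurable_funeM.
have mg' : measurable_fun setT (fun w => (eta / 2 * (1 - L * eta))%:E * (sqnorm (page_g t w))%:E).
  exact: measurable_funeM.
rewrite -ge0_integralD//=; [|exact: gge0|by move=> w _; exact: cge0].
rewrite -ge0_integralD//=; last 3 first.
- by move=> w Tw; apply: adde_ge0; [exact: gge0|exact: cge0].
- exact: emeasurable_funD.
- by move=> w _; exact: cge0.
rewrite -ge0_integralD//=; [|exact: gge0|by move=> w _; exact: cge0].
apply: ge0_le_integral => //.
- by move=> w Tw; apply: adde_ge0; [apply: adde_ge0; [exact: gge0|exact: cge0]|exact: cge0].
- by apply: emeasurable_funD => //; exact: emeasurable_funD.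
- exact: emeasurable_funD.
- move=> w _; rewrite -!EFinM -!EFinD lee_fin page_xS.
  have := @gradient_step_descent R d f L eta (page_x t w) (page_g t w) L_gt0 f_diff grad_lipschitz.
  lra.
Qed.

Lemma moments_ge0 t : [/\ 0 <= gap t, 0 <= error_sq t, 0 <= step_sq t & 0 <= grad_sq t].
Proof.
split; apply: integral_ge0 => w _; rewrite lee_fin ?sqnorm_ge0//.
by rewrite subr_ge0.
Qed.

Lemma gap0 : gap 0 = (f x0 - f xmin)%:E.
Proof.
rewrite /gap (eq_integral (cst (f x0 - f xmin)%:E))//.
by rewrite integral_cst//= probability_setT mule1.
Qed.

(** From a finite gap and error at one time, [gapS] bounds [grad_sq] and then [step_sq_le] bounds
    [step_sq]. With all four finite, [gapS] and [error_sqS] carry gap and error to the next time. *)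
Let moments_finite t :
  [/\ gap t < +oo, error_sq t < +oo, step_sq t < +oo & grad_sq t < +oo].
Proof.
have rest s : gap s < +oo -> error_sq s < +oo ->
    [/\ gap s < +oo, error_sq s < +oo, step_sq s < +oo & grad_sq s < +oo].
  move=> gs es; have [g0 e0 s0 n0] := moments_ge0 s; have [g0' _ _ _] := moments_ge0 s.+1.
  have eta2 : (0 < eta / 2)%R by rewrite divr_gt0.
  have c0 : (0 <= eta / 2 * (1 - L * eta))%R by rewrite mulr_ge0 ?subr_ge0// ltW.
  have ns : grad_sq s < +oo.
    have : (eta / 2)%:E * grad_sq s < +oo.
      apply: le_lt_trans (le_trans _ (gapS s)) _.
        rewrite -addeA addeCA leeDl// adde_ge0//.
        by rewrite mule_ge0// lee_fin.
      by rewrite lte_add_pinfty// lte_mul_pinfty// lee_fin ltW.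
    by case: (grad_sq s) n0 => [x _ _|_|]//; rewrite ?ltry// gt0_muley ?lte_fin.
  split=> //; apply: le_lt_trans (step_sq_le s) _.
  by rewrite lte_add_pinfty// lte_mul_pinfty.
elim: t => [|t [gt et st nt]].
  apply: rest; first by rewrite gap0 ltry.
  by apply: le_lt_trans error_sq0 _; rewrite ltry.
have [g0 e0 s0 n0] := moments_ge0 t; have [g0' e0' s0' _] := moments_ge0 t.+1.
have eta2 : (0 < eta / 2)%R by rewrite divr_gt0.
have c0 : (0 <= eta / 2 * (1 - L * eta))%R by rewrite mulr_ge0 ?subr_ge0// ltW.
apply: rest.
  apply: le_lt_trans (le_trans _ (gapS t)) _.
    rewrite -addeA leeDl// adde_ge0// mule_ge0// lee_fin//.
    exact: ltW.
  by rewrite lte_add_pinfty// lte_mul_pinfty// lee_fin ltW.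
apply: le_lt_trans (error_sqS t) _.
have K0 : (0 <= L ^+ 2 * eta ^+ 2 / b'%:R)%R by rewrite divr_ge0// mulr_ge0 ?sqr_ge0.
rewrite lte_add_pinfty//; first by rewrite -EFinM ltry.
rewrite lte_mul_pinfty// ?lee_fin ?subr_ge0//.
by rewrite lte_add_pinfty// lte_mul_pinfty// lee_fin.
Qed.

Hypothesis p_gt0 : (0 < p)%R.
Hypothesis step_size : ((1 - p) / p * (L ^+ 2 * eta ^+ 2 / b'%:R) <= 1 - L * eta)%R.

Lemma sum_grad_sq (N : nat) : (eta / 2)%:E * \sum_(t < N) grad_sq t <=
  (f x0 - f xmin + eta / 2 * V / p + N%:R * (eta / 2 * V))%:E.
Proof.
have fin t : [/\ gap t = (fine (gap t))%:E, error_sq t = (fine (error_sq t))%:E,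
    step_sq t = (fine (step_sq t))%:E & grad_sq t = (fine (grad_sq t))%:E].
  have [a0 e0 s0 n0] := moments_ge0 t; have [ao eo so no] := moments_finite t.
  by split; rewrite fineK// ge0_fin_numE.
have := @lyapunov_sum R (fine \o gap) (fine \o error_sq) (fine \o grad_sq)
  (fine \o step_sq) eta p V (1 - L * eta) (L ^+ 2 * eta ^+ 2 / b'%:R) N eta_gt0 p_gt0 step_size.
rewrite /= gap0 /= => h.
rewrite (eq_bigr (fun t : 'I_N => (fine (grad_sq t))%:E)); last first.
  by move=> t _; have [_ _ _ {1}->] := fin t.
rewrite sumEFin -EFinM lee_fin; apply: h.
- by move=> t; rewrite fine_ge0//; have [] := moments_ge0 t.
- by move=> t; rewrite fine_ge0//; have [] := moments_ge0 t.
- by move=> t; rewrite fine_ge0//; have [] := moments_ge0 t.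
- move=> t; rewrite -lee_fin !EFinD !EFinM.
  have := gapS t; have [{1 2}-> {1}-> {1}-> {1}->] := fin t; have [{1}-> _ _ _] := fin t.+1.
  by rewrite !EFinM.
- move=> t; rewrite -lee_fin.
  have := error_sqS t; have [_ {1}-> {1}-> _] := fin t; have [_ {1}-> _ _] := fin t.+1.
  by rewrite !(EFinD, EFinM).
- by rewrite -lee_fin; have [_ <- _ _] := fin 0%N; exact: error_sq0.
Qed.

(** * The random output *)

Hypothesis T_gt0 : (0 < T)%N.

(** The output index is independent of all other sources, so the whole trajectory is frozen and the
    uniform law averages over [t < T]. *)
Lemma output_grad_sq :
  \int[P]_w (sqnorm (grad f (page_output pop F x0 eta r w)))%:E =
  (T%:R^-1)%:E * \sum_(t < T) grad_sq t.
Proof.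
pose S := predC1 src_out.
have sub t : subpred (page_past t) S by move=> i; apply: contraTN => /eqP ->.
have mgrad t : past_vector S (fun w => grad f (page_x t w)).
  apply: past_vector_grad; have [mx _] := page_measurable t.
  exact: past_vector_sub (@sub t) mx.
pose h (u : pastType page_events S * nat) := (sqnorm (grad f (page_x u.2 u.1)))%:E.
have mh : measurable_fun setT h.
  apply: (@measurable_fun_nat_param _ _ (pastType page_events S) _
    (fun w k => (sqnorm (grad f (page_x k w)))%:E)) => k.
  apply/measurable_EFinP; exact: (past_vector_sqnorm (@mgrad k)).
have h0 u : 0 <= h u by rewrite lee_fin sqnorm_ge0.
pose mu : probability nat R := distribution P (out r).
have muE t : (t < T)%N -> mu [set t] = (T%:R^-1)%:E by move=> tT; exact: out_law.
rewrite (@page_freeze S src_out _ _ (out r) mu h)//.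
have sumE w : \int[mu]_k h (w, k) =
    \sum_(t < T) (T%:R^-1)%:E * (sqnorm (grad f (page_x t w)))%:E.
  rewrite (@integral_finite_support _ _ _ mu _ (iota 0 T))//; last 2 first.
  - exact: iota_uniq.
  - rewrite -[T in iota _ T]subn0 -/(index_iota 0 T) big_mkord.
    rewrite (eq_bigr (fun=> (T%:R^-1)%:E)); last by move=> t _; rewrite muE.
    rewrite sumEFin sumr_const card_ord -[X in X%:E]mulr_natr mulVf//.
    by rewrite pnatr_eq0 -lt0n.
  rewrite -[T in iota _ T]subn0 -/(index_iota 0 T) big_mkord.
  by apply: eq_bigr => t _; rewrite muE// muleC.
under eq_integral do rewrite sumE.
have T0 : 0 <= (T%:R^-1 : R)%:E by rewrite lee_fin invr_ge0.
have mn t : measurable_fun setT (fun w => (sqnorm (grad f (page_x t w)))%:E).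
  exact: measurable_past_sqnorm (mgrad t).
rewrite ge0_integral_sum//; last 2 first.
- by move=> t; exact: measurable_funeM.
- by move=> t w _; rewrite mule_ge0// lee_fin sqnorm_ge0.
rewrite ge0_sume_distrr; last by move=> t _; have [] := moments_ge0 t.
apply: eq_bigr => t _; rewrite ge0_integralZl//.
by move=> w _; rewrite lee_fin sqnorm_ge0.
Qed.

(** The condition on [T] is [sum_grad_sq] at [N = T] divided by [eta / 2]; it makes the mean squared
    gradient at the output at most [eps ^+ 2]. *)
Lemma page_output_bound (eps : R) : (0 < eps)%R ->
  (2 * (f x0 - f xmin) / eta + V / p + T%:R * V <= T%:R * eps ^+ 2)%R ->
  'E_P[fun w => enorm (grad f (page_output pop F x0 eta r w))] <= eps%:E.
Proof.
move=> eps0 hT; rewrite unlock.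
pose y w := grad f (page_output pop F x0 eta r w).
have my k : measurable_fun setT (fun w => y w ord0 k).
  have mpair : measurable_fun setT (fun w => (w, out r w)).
    apply/measurable_fun_pairP; split; first exact: measurable_id.
    exact: (measurable_funP (out r)).
  have mh : measurable_fun setT
      (fun u : Omega * nat => grad f (page_x u.2 u.1) ord0 k).
    apply: (@measurable_fun_nat_param _ _ _ _ (fun w t => grad f (page_x t w) ord0 k)) => t.
    have [mx _] := page_measurable t.
    exact: past_vector_measurable (past_vector_grad mx).
  exact: (measurableT_comp mh mpair).
have msq := measurable_sqnorm my.
have men : measurable_fun setT (fun w => enorm (y w)).
  have msqrt : measurable_fun setT (@Num.sqrt R).
    by apply: continuous_measurable_fun; exact: sqrt_continuous.
  exact: (measurableT_comp msqrt msq).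
have sq_le : \int[P]_w (sqnorm (y w))%:E <= (eps ^+ 2)%:E.
  rewrite output_grad_sq.
  have T0 : (0 < T%:R :> R)%R by rewrite ltr0n.
  have eta2 : (0 < eta / 2)%R by rewrite divr_gt0.
  have fin : \sum_(t < T) grad_sq t \is a fin_num.
    apply/sum_fin_numP => t _ _; have [_ _ _ nt] := moments_finite t.
    by have [_ _ _ n0] := moments_ge0 t; rewrite ge0_fin_numE.
  have := sum_grad_sq T; rewrite -(fineK fin) -!EFinM !lee_fin => h.
  rewrite ler_pdivrMl// -(ler_pM2l eta2); apply: le_trans h _.
  rewrite -(ler_pM2l eta2) in hT; apply: le_trans hT.
  rewrite le_eqVlt; apply/orP; left; apply/eqP; field.
  by rewrite !gt_eqF.
(* AM-GM in place of Jensen: [2 |y| <= |y|^2 / eps + eps]. *)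
have pt w : (enorm (y w) <= (2 * eps)^-1 * sqnorm (y w) + eps / 2)%R.
  rewrite -enorm_sqr -(ler_pM2l (mulr_gt0 (ltr0n _ 2) eps0)).
  have -> : (2 * eps * ((2 * eps)^-1 * enorm (y w) ^+ 2 + eps / 2) =
    enorm (y w) ^+ 2 + eps ^+ 2)%R by field; rewrite gt_eqF.
  by have := sqr_ge0 (enorm (y w) - eps); nra.
have c0 : (0 <= (2 * eps)^-1)%R by rewrite invr_ge0 mulr_ge0// ltW.
have msqE : measurable_fun setT (fun w => (sqnorm (y w))%:E) by exact/measurable_EFinP.
apply: (@le_trans _ _ (\int[P]_w ((2 * eps)^-1%:E * (sqnorm (y w))%:E + (eps / 2)%:E))).
  apply: ge0_le_integral => //.
  - by move=> w _; rewrite lee_fin enorm_ge0.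
  - exact/measurable_EFinP.
  - by apply: emeasurable_funD => //; exact: measurable_funeM.
  - by move=> w _; rewrite -EFinM -EFinD lee_fin; exact: pt.
rewrite ge0_integralD//=; last 3 first.
- by move=> w _; rewrite -EFinM lee_fin mulr_ge0// sqnorm_ge0.
- exact: measurable_funeM.
- by move=> w _; rewrite lee_fin divr_ge0// ltW.
rewrite ge0_integralZl//; last by move=> w _; rewrite lee_fin sqnorm_ge0.
rewrite integral_cst//= probability_setT mule1.
apply: le_trans (leeD2r _ (lee_wpmul2l _ sq_le)) _; first by rewrite lee_fin.
rewrite -EFinM -EFinD lee_fin le_eqVlt; apply/orP; left; apply/eqP; field.
by rewrite gt_eqF.
Qed.

End page_analysis.

(** * Expected number of gradient computations *)

Section page_costs.
Local Open Scope ereal_scope.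
Context {R : realType} {dO : measure_display} {Omega : measurableType dO}.
Context {dZ : measure_display} {Z : measurableType dZ}.
Context {P : probability Omega R} {D : probability Z R}.
Context {b b' : nat} {p : R} {T : nat}.
Variable r : page_randomness P D b b' (fun=> p) T.

Lemma expectation_coin t (u v : R) : (0 <= u)%R -> (0 <= v)%R ->
  \int[P]_w (if coin r t w then u else v)%:E = (p * u + (1 - p) * v)%:E.
Proof.
move=> u0 v0.
pose mu : probability bool R := distribution P (coin r t).
have mu_t : mu [set true] = p%:E by exact: coin_law.
have mu_f : mu [set false] = (1 - p)%:E by exact: coin_law_false.
pose g (c : bool) := (if c then u else v)%:E.
transitivity (\int[mu]_c g c).
  rewrite ge0_integral_distribution//.
  by move=> c; rewrite /g lee_fin; case: ifP.
rewrite (@integral_finite_support _ _ _ mu g [:: true; false])//.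
- by rewrite !big_cons big_nil mu_t mu_f /g adde0 -!EFinM -EFinD mulrC [X in (_ + X)%R]mulrC.
- by rewrite !big_cons big_nil mu_t mu_f adde0 -EFinD addrC subrK.
- by move=> c; rewrite /g lee_fin; case: ifP.
Qed.

Lemma expectation_grad_count :
  'E_P[page_grad_count r] = (b%:R + T%:R * (p * b%:R + (1 - p) * b'%:R))%:E.
Proof.
rewrite unlock.
have E w : (page_grad_count r w)%:E =
    (b%:R : R)%:E + \sum_(t < T) (if coin r t w then b%:R else b'%:R : R)%:E.
  rewrite /page_grad_count natrD natr_sum EFinD -sumEFin; congr (_ + _).
  by apply: eq_bigr => t _; case: ifP.
under eq_integral do rewrite E.
have mt t : measurable_fun setT (fun w => (if coin r t w then b%:R else b'%:R : R)%:E).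
  by apply/measurable_EFinP; apply: measurable_fun_ifT.
have t0 t w : 0 <= (if coin r t w then b%:R else b'%:R : R)%:E.
  by rewrite lee_fin; case: ifP.
rewrite ge0_integralD//=; last 2 first.
- by move=> w _; exact: sume_ge0.
- exact: emeasurable_sum.
rewrite integral_cst//= probability_setT mule1 ge0_integral_sum//.
under eq_bigr do rewrite expectation_coin//.
by rewrite sumEFin -EFinD sumr_const card_ord [in RHS]mulr_natl.
Qed.

End page_costs.

(** * Minibatch gradients and the finite-sum case *)

Section minibatch_gradients.
Context {R : realType} {dO : measure_display} {Omega : measurableType dO}.
Context {dZ : measure_display} {Z : measurableType dZ}.
Context {P : probability Omega R} {D : probability Z R}.
Context {b b' : nat} {p : R} {T : nat} {d : nat}.
Variable r : page_randomness P D b b' (fun=> p) T.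
Variables (F : Z -> 'rV[R]_d -> R) (f : 'rV[R]_d -> R).

(** Since [D] is the empirical law of [zs], the average over the list is the expectation under [D],
    coordinate by coordinate. *)
Lemma full_batch_grad zs t w x : stochastic_objective D F f ->
  population D (Some zs) -> size zs = b ->
  batch_grad r (Some zs) F t w x = grad f x.
Proof.
move=> [_ _ _ gF] popz szs; rewrite /batch_grad /= size_map size_enum_ord szs eqxx szs.
apply/rowP => k; rewrite mxE summxE.
have [gi ge] := gF x k; apply: EFin_inj.
have mg : measurable_fun setT (fun z => grad (F z) x ord0 k).
  by apply/measurable_EFinP; exact: measurable_int gi.
have := integral_empirical popz mg; rewrite szs => <-.
by rewrite -ge unlock.
Qed.

(** The premise holds for an infinite population and for a finite one whose size differs from
    [b]. *)
Lemma sampled_batch_grad pop t w x :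
  (forall s : seq Z, size s = b -> minibatch pop s = s) ->
  batch_grad r pop F t w x =
  b%:R^-1 *: \sum_(j <- enum 'I_b) grad (F (draw r t j w)) x.
Proof.
move=> popE; rewrite /batch_grad popE; last by rewrite size_map size_enum_ord.
by rewrite size_map size_enum_ord big_map.
Qed.

End minibatch_gradients.

Section finite_population.
Context {R : realType} {d n : nat}.
Variables (f_ : 'I_n.+1 -> 'rV[R]_d -> R) (f : 'rV[R]_d -> R).

Lemma population_uniform_index :
  population (uniform_index R n) (Some (enum 'I_n.+1)).
Proof.
split; first by rewrite size_enum_ord.
move=> A mA; rewrite /uniform_index /mscale/= /msum size_enum_ord EFinM.
congr (_ * _)%E; rewrite -sumEFin big_enum/=; apply: eq_bigr => i _.
by rewrite /dirac inord_val.
Qed.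

Lemma integrable_uniform_index (X : 'I_n.+1 -> R) :
  (uniform_index R n).-integrable setT (fun i => (X i)%:E).
Proof.
apply/integrableP; split => //.
under eq_integral do rewrite abse_EFin.
have := expectation_uniform_index (fun i => `|X i|); rewrite unlock => ->.
exact: ltry.
Qed.

(** Lets the finite-sum case run through the same analysis as the online one, with [uniform_index]
    as sampling law. *)
Lemma finite_sum_objective :
  (forall i x, differentiable (f_ i) x) ->
  (forall x, f x = n.+1%:R^-1 * \sum_i f_ i x) ->
  stochastic_objective (uniform_index R n) f_ f.
Proof.
move=> fd fE.
have -> : f = n.+1%:R^-1 \*: (\sum_i f_ i).
  by apply/funext => x; rewrite fE /= fct_sumE.
have sd x : differentiable (\sum_i f_ i) x by exact: differentiable_sum.
split=> //.
- move=> x; split; first exact: integrable_uniform_index.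
  by rewrite expectation_uniform_index /= fct_sumE.
- by move=> x; exact: differentiableZ.
- move=> x j; split; first exact: integrable_uniform_index.
  rewrite expectation_uniform_index mxE.
  rewrite deriveZ/=; last exact: diff_derivable.
  rewrite derive_sum; last by move=> i; exact: diff_derivable.
  by congr (_ * _)%:E; apply: eq_bigr => i _; rewrite mxE.
Qed.

End finite_population.

(** * Complexity bounds *)

Section page_parameters.
Context {R : realType}.
Variables (b b' : nat).
Hypothesis b'_ge1 : (1 <= b')%N.
Hypothesis b'_le : b'%:R <= Num.sqrt b%:R :> R.

Let p : R := b'%:R / (b + b')%:R.
Let kappa : R := Num.sqrt ((1 - p) / (p * b'%:R)).

Let c1 : 1 <= b'%:R :> R. Proof. by rewrite ler1n. Qed.
Let c0 : 0 < b'%:R :> R. Proof. by rewrite ltr0n. Qed.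

Lemma batch_size_gt0 : (0 < b)%N.
Proof.
by case: b b'_le => // ; rewrite sqrtr0 => h; have := lt_le_trans c0 h; rewrite ltxx.
Qed.

Let b0 : 0 < b%:R :> R. Proof. by rewrite ltr0n batch_size_gt0. Qed.
Let bb'0 : 0 < b%:R + b'%:R :> R. Proof. by rewrite addr_gt0. Qed.
Let pE : p = b'%:R / (b%:R + b'%:R). Proof. by rewrite /p natrD. Qed.

Lemma page_prob_gt0 : 0 < p.
Proof. by rewrite pE divr_gt0. Qed.

Lemma page_kappa_ge0 : 0 <= kappa.
Proof. exact: sqrtr_ge0. Qed.

Lemma page_kappa_sqr : kappa ^+ 2 = (1 - p) / (p * b'%:R).
Proof.
rewrite sqr_sqrtr// divr_ge0//; last by rewrite mulr_ge0// ltW// page_prob_gt0.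
rewrite subr_ge0 pE ler_pdivrMr// mul1r lerDr; exact: ltW.
Qed.

(** For this [p] the ratio under the root is [b / b' ^ 2], so [kappa] equals [sqrt b / b']; the
    condition [b' <= sqrt b] bounds the summand [1] by the same quantity. *)
Lemma page_kappa_le : 1 + kappa <= 2 * Num.sqrt b%:R / b'%:R.
Proof.
have -> : kappa = Num.sqrt b%:R / b'%:R.
  apply/eqP; rewrite -(@eqrXn2 _ 2)// ?divr_ge0 ?sqrtr_ge0//.
  rewrite page_kappa_sqr pE exprMn sqr_sqrtr ?ltW// exprVn; apply/eqP; field.
  by rewrite !gt_eqF//= addrK gt_eqF.
by rewrite -mulrA mulrDl mul1r lerD2r ler_pdivlMr// mul1r.
Qed.

(** The choice of [p] balances the two kinds of update: [p * b] and [(1 - p) * b'] are both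
    [b * b' / (b + b')]. *)
Lemma page_iteration_cost : p * b%:R + (1 - p) * b'%:R = 2 * b%:R * b'%:R / (b%:R + b'%:R).
Proof. by rewrite pE; field; rewrite gt_eqF. Qed.

Lemma page_iteration_cost_ge0 : 0 <= p * b%:R + (1 - p) * b'%:R.
Proof. by rewrite page_iteration_cost divr_ge0 ?mulr_ge0 ?ltW. Qed.

Lemma page_iteration_cost_le : p * b%:R + (1 - p) * b'%:R <= 2 * b'%:R.
Proof.
rewrite page_iteration_cost ler_pdivrMr// -mulrA [b%:R * _]mulrC -mulrA ler_pM2l//.
by rewrite ler_pM2l// lerDl ltW.
Qed.

(** Put [s = L * eta * kappa]. The step bound reads [L * eta + s <= 1], the left side of the second
    claim is [s ^+ 2], and [0 <= s <= 1] gives [s ^+ 2 <= s <= 1 - L * eta]. *)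
Lemma page_step_size (L eta : R) : 0 < L -> 0 < eta -> eta <= (L * (1 + kappa))^-1 ->
  L * eta <= 1 /\
  (1 - p) / p * (L ^+ 2 * eta ^+ 2 / b'%:R) <= 1 - L * eta.
Proof.
move=> L0 eta0 heta; have k0 := page_kappa_ge0.
have k1 : 0 < 1 + kappa by rewrite (lt_le_trans ltr01)// lerDl.
have Leta0 : 0 < L * eta by exact: mulr_gt0.
have h : L * eta * (1 + kappa) <= 1.
  by rewrite mulrAC mulrC -ler_pdivlMr ?mulr_gt0// mul1r.
have h1 : 0 <= L * eta * kappa by rewrite mulr_ge0// ltW.
split; first by move: h; rewrite mulrDr mulr1; lra.
have -> : (1 - p) / p * (L ^+ 2 * eta ^+ 2 / b'%:R) = (L * eta * kappa) ^+ 2.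
  by rewrite [RHS]exprMn page_kappa_sqr; field; rewrite !gt_eqF// page_prob_gt0.
by move: h; rewrite mulrDr mulr1 => h; nra.
Qed.

(** Both cases at once: [(k, q)] is [(2, 0)] for the finite sum and [(4, 1)] online. The [q / p]
    extra iterations cost exactly [2 * q * b], since [1 / p] is [(b + b') / b']. *)
Lemma page_complexity (L Delta eps A k q : R) : 0 < L -> 0 <= Delta -> 0 < eps ->
  0 <= k -> 0 <= q -> A = k * L * Delta / eps ^+ 2 * (1 + kappa) ->
  A <= 2 * k * L * Delta * Num.sqrt b%:R / (eps ^+ 2 * b'%:R) /\
  (A + q / p) * (p * b%:R + (1 - p) * b'%:R) <=
    4 * k * L * Delta * Num.sqrt b%:R / eps ^+ 2 + 2 * q * b%:R.
Proof.
move=> L0 Delta0 eps0 k0 q0 AE.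
pose C := k * L * Delta / eps ^+ 2.
have C0 : 0 <= C by rewrite divr_ge0 ?sqr_ge0// !mulr_ge0// ltW.
have hA : A <= C * (2 * Num.sqrt b%:R / b'%:R).
  by rewrite AE ler_wpM2l// page_kappa_le.
have eps2 : eps != 0 by rewrite gt_eqF.
split.
  apply: le_trans hA _; rewrite le_eqVlt; apply/orP; left; apply/eqP.
  by rewrite /C; field; rewrite eps2 gt_eqF.
rewrite mulrDl; apply: lerD.
  apply: le_trans (ler_wpM2r page_iteration_cost_ge0 hA) _.
  have s0 : 0 <= C * (2 * Num.sqrt b%:R / b'%:R).
    by rewrite mulr_ge0// divr_ge0 ?mulr_ge0 ?sqrtr_ge0.
  apply: le_trans (ler_wpM2l s0 page_iteration_cost_le) _.
  rewrite le_eqVlt; apply/orP; left; apply/eqP.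
  by rewrite /C; field; rewrite eps2 gt_eqF.
rewrite page_iteration_cost pE le_eqVlt; apply/orP; left; apply/eqP.
by field; rewrite !gt_eqF.
Qed.

(** The factor [Num.max 1 LD] dominates both [1] and [LD], so a single absolute constant covers both
    summands. *)
Lemma page_big_O (LD eps ngrad : R) : 0 <= LD ->
  ngrad <= 3 * b%:R + 16 * (LD * Num.sqrt b%:R / eps ^+ 2) ->
  ngrad <= 16 * Num.max 1 LD * (b%:R + Num.sqrt b%:R / eps ^+ 2).
Proof.
move=> LD0 h; apply: le_trans h _.
set u := Num.sqrt b%:R / eps ^+ 2.
have u0 : 0 <= u by rewrite divr_ge0 ?sqrtr_ge0// sqr_ge0.
have -> : LD * Num.sqrt b%:R / eps ^+ 2 = LD * u by rewrite mulrA.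
have M1 : 1 <= Num.max 1 LD by rewrite le_max lexx.
have MLD : LD <= Num.max 1 LD by rewrite le_max lexx orbT.
have h1 : b%:R <= Num.max 1 LD * b%:R by rewrite ler_peMl// ltW.
have h2 : LD * u <= Num.max 1 LD * u by rewrite ler_wpM2r.
have := ltW b0; lra.
Qed.

End page_parameters.

(** [K] is chosen before all problem data, which makes the O-bounds uniform. In each case the
    accuracy claim is given for every admissible step through a threshold on [T] depending on [eta];
    the displayed [T] is this threshold at the largest admissible step. *)
Theorem theorem1 (R : realType) :
  exists2 K : R, 0 < K &
  (* finite-sum case *)
  (forall (d n : nat) (f_ : 'I_n.+1 -> 'rV[R]_d -> R) (f : 'rV[R]_d -> R)
      (L eps : R) (x0 xmin : 'rV[R]_d) (b b' : nat),
    (forall i x, differentiable (f_ i) x) ->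
    (forall x, f x = n.+1%:R^-1 * \sum_i f_ i x) ->
    (forall x, f xmin <= f x) ->
    0 < L -> average_smooth (uniform_index R n) f_ L ->
    0 < eps ->
    b = n.+1 -> (1 <= b')%N -> b'%:R <= Num.sqrt b%:R :> R ->
    let Delta0 := f x0 - f xmin in
    let p : R := b'%:R / (b + b')%:R in
    let kappa := Num.sqrt ((1 - p) / (p * b'%:R)) in
    forall eta : R, 0 < eta -> eta <= (L * (1 + kappa))^-1 ->
    forall T : nat, (0 < T)%N ->
    forall (dO : measure_display) (Omega : measurableType dO)
      (P : probability Omega R)
      (r : page_randomness P (uniform_index R n) b b' (fun=> p) T),
    let Egrad := ('E_P[fun w =>
      enorm (grad f (page_output (Some (enum 'I_n.+1)) f_ x0 eta r w))])%E in
    (2 * Delta0 / (eta * eps ^+ 2) <= T%:R -> (Egrad <= eps%:E)%E) /\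
    (T%:R = 2 * L * Delta0 / eps ^+ 2 * (1 + kappa) ->
     [/\ eta = (L * (1 + kappa))^-1 -> (Egrad <= eps%:E)%E,
         T%:R <= 4 * L * Delta0 * Num.sqrt n.+1%:R / (eps ^+ 2 * b'%:R)
       & let ngrad : R := b%:R + T%:R * (p * b%:R + (1 - p) * b'%:R) in
         [/\ ('E_P[page_grad_count r] = ngrad%:E)%E,
             ngrad <= n.+1%:R + 8 * L * Delta0 * Num.sqrt n.+1%:R / eps ^+ 2
           & ngrad <= K * Num.max 1 (L * Delta0) *
                      (n.+1%:R + Num.sqrt n.+1%:R / eps ^+ 2)]])) /\
  (* online case *)
  (forall (d : nat) (dZ : measure_display) (Z : measurableType dZ)
      (D : probability Z R) (pop : option (seq Z))
      (F : Z -> 'rV[R]_d -> R) (f : 'rV[R]_d -> R)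
      (L sigma eps : R) (x0 xmin : 'rV[R]_d) (b b' : nat),
    population D pop ->
    stochastic_objective D F f ->
    (forall x, f xmin <= f x) ->
    0 < L -> average_smooth D F L ->
    0 < sigma -> bounded_variance D F f sigma ->
    0 < eps ->
    b = (let m := `|Num.ceil (2 * sigma ^+ 2 / eps ^+ 2)|%N in
         if pop is Some zs then minn m (size zs) else m) ->
    (1 <= b')%N -> b'%:R <= Num.sqrt b%:R :> R ->
    let Delta0 := f x0 - f xmin in
    let p : R := b'%:R / (b + b')%:R in
    let kappa := Num.sqrt ((1 - p) / (p * b'%:R)) in
    forall eta : R, 0 < eta -> eta <= (L * (1 + kappa))^-1 ->
    forall T : nat, (0 < T)%N ->
    forall (dO : measure_display) (Omega : measurableType dO)
      (P : probability Omega R) (r : page_randomness P D b b' (fun=> p) T),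
    let Egrad := ('E_P[fun w =>
      enorm (grad f (page_output pop F x0 eta r w))])%E in
    (4 * Delta0 / (eta * eps ^+ 2) + p^-1 <= T%:R -> (Egrad <= eps%:E)%E) /\
    (T%:R = 4 * L * Delta0 / eps ^+ 2 * (1 + kappa) + p^-1 ->
     [/\ eta = (L * (1 + kappa))^-1 -> (Egrad <= eps%:E)%E,
         T%:R <= 8 * L * Delta0 * Num.sqrt b%:R / (eps ^+ 2 * b'%:R) +
                 (b + b')%:R / b'%:R
       & let ngrad : R := b%:R + T%:R * (p * b%:R + (1 - p) * b'%:R) in
         [/\ ('E_P[page_grad_count r] = ngrad%:E)%E,
             ngrad <= 3 * b%:R + 16 * L * Delta0 * Num.sqrt b%:R / eps ^+ 2
           & ngrad <= K * Num.max 1 (L * Delta0) *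
                      (b%:R + Num.sqrt b%:R / eps ^+ 2)]])).
Proof.
(* The largest coefficient in the two gradient counts, [16] from the online case. *)
exists 16; first by rewrite ltr0n.
split.
- move=> d n f_ f L eps x0 xmin b b' fd fE fmin L0 Lf eps0 bE b'1 b's Delta0 p kappa
    eta eta0 heta T T0 dO Omega P r Egrad.
  have b0 := batch_size_gt0 b'1 b's.
  have D0 : 0 <= Delta0 by rewrite subr_ge0.
  have [Leta step] := page_step_size b'1 b's L0 eta0 heta.
  have obj := finite_sum_objective fd fE.
  have fullP t w x : batch_grad r (Some (enum 'I_n.+1)) f_ t w x = grad f x.
    apply: (full_batch_grad _ _ _ _ obj); first exact: population_uniform_index.
    by rewrite size_enum_ord bE.
  have bound : 2 * Delta0 / (eta * eps ^+ 2) <= T%:R -> (Egrad <= eps%:E)%E.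
    (* The full minibatch is exact, so [V = 0] and only the term in [Delta0] remains. *)
    move=> hT; apply: (page_output_bound b'1 b0 L0 obj Lf (or_introl fullP) (lexx 0)
      fmin eta0 Leta (page_prob_gt0 b'1 b's) step T0 eps0).
    rewrite mul0r mulr0 !addr0 -ler_pdivrMr ?exprn_gt0//; apply: le_trans hT.
    by rewrite [in leRHS]invfM mulrA.
  split=> // TE.
  have [hT hcost] := page_complexity b'1 b's L0 D0 eps0 (ler0n _ 2) (lexx 0) TE.
  rewrite -/p mul0r addr0 mulr0 mul0r addr0 in hcost.
  have hngrad : b%:R + T%:R * (p * b%:R + (1 - p) * b'%:R) <=
      n.+1%:R + 8 * L * Delta0 * Num.sqrt n.+1%:R / eps ^+ 2.
    by rewrite -bE lerD2l; apply: le_trans hcost _; rewrite -natrM.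
  split.
  + move=> etaE; apply: bound; rewrite etaE TE le_eqVlt; apply/orP; left; apply/eqP.
    have k0 : 0 < 1 + kappa by rewrite (lt_le_trans ltr01)// lerDl page_kappa_ge0.
    by field; rewrite !gt_eqF.
  + by rewrite -bE; apply: le_trans hT _; rewrite -natrM.
  + split=> //; first exact: expectation_grad_count.
    rewrite -bE; apply: (page_big_O b'1 b's); first by rewrite mulr_ge0// ltW.
    have s0 : 0 <= L * Delta0 * Num.sqrt b%:R / eps ^+ 2.
      by rewrite divr_ge0 ?sqr_ge0// !mulr_ge0 ?sqrtr_ge0// ltW.
    apply: le_trans hngrad _; rewrite -bE.
    have -> : 8 * L * Delta0 * Num.sqrt b%:R / eps ^+ 2 =
      8 * (L * Delta0 * Num.sqrt b%:R / eps ^+ 2) by rewrite !mulrA.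
    have : 0 <= b%:R :> R by []. 
    lra.
- move=> d dZ Z D pop F f L sigma eps x0 xmin b b' popD obj fmin L0 Lf sigma0 varF eps0 bE
    b'1 b's Delta0 p kappa eta eta0 heta T T0 dO Omega P r Egrad.
  have b0 := batch_size_gt0 b'1 b's.
  have D0 : 0 <= Delta0 by rewrite subr_ge0.
  have eps20 : 0 < eps ^+ 2 by rewrite exprn_gt0.
  have p0 : 0 < p := page_prob_gt0 b'1 b's.
  have [Leta step] := page_step_size b'1 b's L0 eta0 heta.
  (* Either [b] is the population size and the large minibatch is exact, or [b] is the ceiling and
     the draws are really used; the level [eps ^+ 2 / 2] serves in both situations. *)
  have batchP : (forall t w x, batch_grad r pop F t w x = grad f x) \/
      (forall t w x, batch_grad r pop F t w x =
         b%:R^-1 *: \sum_(j <- enum 'I_b) grad (F (draw r t j w)) x) /\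
      (exists2 s, bounded_variance D F f s & s ^+ 2 / b%:R <= eps ^+ 2 / 2).
    have sampled : (forall s : seq Z, size s = b -> minibatch pop s = s) ->
        b = `|Num.ceil (2 * sigma ^+ 2 / eps ^+ 2)|%N ->
        (forall t w x, batch_grad r pop F t w x =
           b%:R^-1 *: \sum_(j <- enum 'I_b) grad (F (draw r t j w)) x) /\
        (exists2 s, bounded_variance D F f s & s ^+ 2 / b%:R <= eps ^+ 2 / 2).
      move=> popE bm; split; first by move=> t w x; exact: sampled_batch_grad.
      have m0 : 0 <= 2 * sigma ^+ 2 / eps ^+ 2.
        by apply: divr_ge0; [apply: mulr_ge0 => //|]; exact: sqr_ge0.
      (* The ceiling gives [b >= 2 * sigma ^+ 2 / eps ^+ 2], that is, variance at most
         [eps ^+ 2 / 2] for the minibatch mean. *)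
      have : 2 * sigma ^+ 2 / eps ^+ 2 <= b%:R.
        rewrite bm [leRHS]pmulrn gez0_abs; first exact: ceil_ge.
        by rewrite ceil_ge0 (lt_le_trans _ m0)// ltrN10.
      rewrite ler_pdivrMr// => hb.
      by exists sigma => //; rewrite ler_pdivrMr ?ltr0n//; lra.
    case: pop popD bE r Egrad sampled => [zs|] popD bE r Egrad sampled; last first.
      by right; apply: sampled.
    have [szs|szs] := eqVneq b (size zs).
      by left=> t w x; exact: (full_batch_grad _ _ _ _ obj popD (esym szs)).
    right; apply: sampled; first by move=> s sb; rewrite /= sb (negbTE szs).
    by move: bE szs; rewrite /minn; case: ifP => // _ ->; rewrite eqxx.
  have bound : 4 * Delta0 / (eta * eps ^+ 2) + p^-1 <= T%:R -> (Egrad <= eps%:E)%E.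
    move=> hT; apply: (page_output_bound b'1 b0 L0 obj Lf batchP _
      fmin eta0 Leta p0 step T0 eps0); first by rewrite divr_ge0// ltW.
    (* With [V = eps ^+ 2 / 2], the noise takes half of [T * eps ^+ 2]. What remains must pay for
       [2 * Delta0 / eta] and for the initial error [V / p], whence the constant [4] and the extra
       [p^-1]. *)
    have : (4 * Delta0 / (eta * eps ^+ 2) + p^-1) * (eps ^+ 2 / 2) <= T%:R * (eps ^+ 2 / 2).
      by rewrite ler_wpM2r// divr_ge0// ltW.
    have -> : (4 * Delta0 / (eta * eps ^+ 2) + p^-1) * (eps ^+ 2 / 2) =
        2 * Delta0 / eta + eps ^+ 2 / 2 / p by field; rewrite !gt_eqF.
    rewrite -/Delta0; lra.
  split=> // TE.
  (* [page_complexity] bounds the part [A] of [T] without the [p^-1] iterations and adds these back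
     through [q = 1]. *)
  have AE : T%:R - p^-1 = 4 * L * Delta0 / eps ^+ 2 * (1 + kappa) by rewrite TE addrK.
  have [hT hcost] := page_complexity b'1 b's L0 D0 eps0 (ler0n _ 4) ler01 AE.
  rewrite -/p mul1r mulr1 subrK in hcost.
  have hngrad : b%:R + T%:R * (p * b%:R + (1 - p) * b'%:R) <=
      3 * b%:R + 16 * L * Delta0 * Num.sqrt b%:R / eps ^+ 2.
    have e16 : (4 * 4 : R) = 16 by rewrite -natrM.
    by rewrite e16 in hcost; lra.
  split.
  + move=> etaE; apply: bound; rewrite etaE TE le_eqVlt; apply/orP; left; apply/eqP.
    have k0 : 0 < 1 + kappa by rewrite (lt_le_trans ltr01)// lerDl page_kappa_ge0.
    by field; rewrite !gt_eqF.
  + have e8 : (2 * 4 : R) = 8 by rewrite -natrM.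
    rewrite e8 in hT.
    have <- : p^-1 = (b + b')%:R / b'%:R by rewrite /p invf_div.
    by rewrite -lerBlDr.
  + split=> //; first exact: expectation_grad_count.
    apply: (page_big_O b'1 b's); first by rewrite mulr_ge0// ltW.
    by rewrite !mulrA in hngrad *.
Qed.
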